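(* Let $(P_m)_{m\ge 1}$ be the min-choice preferential attachment tree. With high probability as $m\to\infty$, the maximum degree of $P_m$ is $\frac{\log\log m}{\log 2}+\Theta(1)$; that is, there is a constant $K>0$ such that, writing $\Delta(P_m)$ for the maximum vertex degree of $P_m$, $$\Pr\left[\left|\Delta(P_m)-\frac{\log\log m}{\log 2}\right|\le K\right]\to 1\quad\text{as } m\to\infty.$$
   Context: The min-choice preferential attachment tree is the random sequence of trees $(P_m)_{m\ge1}$ defined as follows. $P_1$ is the tree with one edge, on vertices $v_1,v_2$. Given $P_{m-1}$ (which has $m-1$ edges and vertices $v_1,\dots,v_m$) with $m\ge2$, one obtains $P_m$ by adding a new vertex $v_{m+1}$ and one new edge: let $X^1_m,X^2_m$ be (conditionally on the past) i.i.d. vertices of $P_{m-1}$, each chosen with probability proportional to degree, i.e. $\Pr[X^1_m=w]=\frac{\deg w}{2(m-1)}$, where $\deg w$ is the degree of $w$ in $P_{m-1}$. Let $Y_m$ be whichever of $X^1_m,X^2_m$ has smaller degree in $P_{m-1}$, a tie being broken by an independent fair coin toss. The new edge joins $v_{m+1}$ to $Y_m$. An event $\mathcal{E}_m$ occurs with high probability if $\Pr(\mathcal{E}_m)\to1$ as $m\to\infty$. Here the notation $\Theta(1)$ denotes an additive error bounded in absolute value by a constant independent of $m$. *)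

(* Defs.v *)
From HB Require Import structures.
From mathcomp Require Import all_boot all_order all_algebra.
From mathcomp Require Import all_classical all_reals all_analysis.

Set Implicit Arguments.
Unset Strict Implicit.
Unset Printing Implicit Defensive.

Import Order.TTheory GRing.Theory Num.Theory.
Import numFieldNormedType.Exports.

Local Open Scope classical_set_scope.
Local Open Scope ring_scope.

(* A tree with n edges is the list of its edges; its vertices v_1, ..., v_(n+1)
   are represented by the natural numbers 1, ..., n+1. *)
Definition ltree : Type := seq (nat * nat).

Definition degree (t : ltree) (v : nat) : nat :=
  count (fun e => (e.1 == v) || (e.2 == v)) t.

Definition max_degree (t : ltree) : nat :=
  (\max_(1 <= v < (size t).+2) degree t v)%N.

(* The coin [b] is only used to break ties. *)
Definition min_choice (t : ltree) (x y : nat) (b : bool) : nat :=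
  if (degree t x < degree t y)%N then x
  else if (degree t y < degree t x)%N then y
  else if b then x else y.

(* The probability that a degree-biased random vertex of [t] equals [v]: the
   total degree is twice the number of edges.  It is 0 if [v] is not a vertex. *)
Definition deg_prob (R : realType) (t : ltree) (v : nat) : R :=
  (degree t v)%:R / (2 * size t)%N%:R.

(* [P m.-1] lists the edges in reverse order of insertion, so it determines the
   whole past P_1, ..., P_(m-1).  The last clause thus says that, conditionally
   on the past, X1 m and X2 m are i.i.d. degree-biased vertices of P_(m-1) and
   coin m is a fair coin independent of them; it is written without division so
   that null values [t] need no special treatment.  The values at m = 0 are
   irrelevant. *)
Record min_choice_pa_tree d (Omega : measurableType d) (R : realType)
    (Pr : probability Omega R) (P : nat -> Omega -> ltree)
    (X1 X2 : nat -> {RV Pr >-> nat}) (coin : nat -> {RV Pr >-> bool}) : Prop :=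
  MinChoicePATree {
    pa_init : forall w, P 1%N w = [:: (1%N, 2%N)];
    pa_step : forall m w, (2 <= m)%N ->
      P m w = (min_choice (P m.-1 w) (X1 m w) (X2 m w) (coin m w), m.+1)
                :: P m.-1 w;
    pa_choices : forall m (t : ltree) (x y : nat) (b : bool), (2 <= m)%N ->
      Pr [set w | [/\ P m.-1 w = t, X1 m w = x, X2 m w = y & coin m w = b]] =
      (Pr [set w | P m.-1 w = t] *
        (deg_prob R t x * deg_prob R t y * 2^-1)%:E)%E
  }.

Definition with_high_probability d (Omega : measurableType d) (R : realType)
    (Pr : probability Omega R) (E : nat -> set Omega) : Prop :=
  Pr (E m) @[m --> \oo] --> 1%E.

(* Main.v *)
Require Import Defs.
From mathcomp Require Import all_boot all_order all_algebra.
From mathcomp Require Import all_classical all_reals all_analysis.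
From mathcomp Require Import zify ring lra.

(** Write E_k for the sum of the degrees of the vertices of degree at least k
    in a tree with n edges, so that E_1 = 2n, and p_k = E_k / 2n for the
    probability that one degree-biased vertex has degree at least k.  The new
    vertex attaches to a vertex of degree at least k exactly when both choices
    do, that is with conditional probability p_k^2.  For k >= 2 the step then
    increases E_k by 1; it increases E_k by k when the parent has degree k - 1;
    and it leaves E_k unchanged otherwise.  Hence the mean increment of E_k is

      k p_(k-1)^2 - (k-1) p_k^2,

    and p_k relaxes to a value of order p_(k-1)^2.  The proportions p_k thus
    decay like exp(-c 2^k), and they fall below 1/n, which forbids degrees
    above k, when 2^k is of order log n.  Both bounds on the maximum degree make
    this quantitative, up to O(1) in k.

    Lower bound ([prob_max_degree_small]).  E_k never decreases, and it grows by
    at least 1 with probability at least p_(k-1)^2.  Splitting the time up to m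
    into successive blocks of about m/2, m/4, m/8, ... steps, one level for each
    block, gives E_k >= m g_k with g_k of order g_(k-1)^2 / 2^k, hence doubly
    exponentially small and no smaller; the failure probabilities are controlled
    by the exponential moments of -E_k.

    Upper bound ([prob_max_degree_large]).  Suppose that p_(k-1) <= a from some
    time on.  Whenever E_k exceeds the line 2bn, its drift is below the slope of
    this line by eta, as soon as k a^2 + eta <= 2b + (k-1) b^2.  An exponential
    moment of the excess over the line therefore stays bounded, and a sum over
    all times shows that E_k stays below a slightly steeper line for ever,
    except with exponentially small probability ([prob_level]).  Using b = k a^2
    at every level would square the density each time, but the factor k makes
    this useful only once the density is below a threshold of order 1/k, while
    p_1 = 1.  The term (k-1) b^2 is what gets the induction started: eight
    explicit numerical steps give p_9 <= 1/72 eventually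
    ([eventually_light9]).  From there the doubly exponential regime is followed
    level by level, the level 9 + l being controlled from time
    S 16^l 2^(2^l) on, and all failure probabilities sum to a quantity that
    vanishes when the constant S grows ([prob_off_track]).  On the good event,
    the probability that the parent of the n-th vertex has degree much larger
    than allowed at time n is O(n^(-3/2)); this is summable, and it excludes
    parents of degree log_2 log_2 m + 10 up to time m.

    All of this takes place in the Markov chain of recursive trees, whose
    one-step expectation [mean_step] is a finite sum.  Since a tree is the list
    of its edges in reverse order of insertion, it contains its own past: the
    tails of the list are the earlier trees, and properties of whole
    trajectories are predicates on trees ([always]).  The theorem is transferred
    to the given probability space by [Pr_pa]. *)

Set Implicit Arguments.
Unset Strict Implicit.
Unset Printing Implicit Defensive.

Import Order.TTheory GRing.Theory Num.Theory.
Import numFieldNormedType.Exports.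

Local Open Scope classical_set_scope.
Local Open Scope ring_scope.

Arguments degree : simpl never.

(** * Recursive trees and the sum of large degrees *)

(** The reachable trees: the vertex with the largest label is a leaf attached to
    an older vertex.  The empty list stands for the tree with the single
    vertex 1. *)
Fixpoint recursive_tree (t : ltree) : bool :=
  if t is e :: u then
    [&& (0 < e.1 <= (size u).+1)%N, e.2 == (size u).+2 & recursive_tree u]
  else true.

Definition attach (t : ltree) (v : nat) : ltree := (v, (size t).+2) :: t.

Definition heavy (k : nat) (t : ltree) : nat :=
  (\sum_(v < (size t).+2 | k <= degree t v) degree t v)%N.

Lemma recursive_tree_attach t v :
  recursive_tree t -> (0 < v <= (size t).+1)%N -> recursive_tree (attach t v).
Proof. by move=> tree_t v_t; rewrite /= v_t eqxx. Qed.

Lemma degree_cons e t v :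
  degree (e :: t) v = (((e.1 == v) || (e.2 == v)) + degree t v)%N.
Proof. by []. Qed.

Lemma degree_outside t v :
  recursive_tree t -> ~~ (0 < v <= (size t).+1)%N -> degree t v = 0%N.
Proof.
elim: t => [//|[x y] t IHt] /= /and3P[/= x_t /eqP -> tree_t] out.
rewrite degree_cons IHt //=; last by lia.
by have -> : (x == v) || ((size t).+2 == v) = false by lia.
Qed.

Lemma degree_attach t v w :
  recursive_tree t -> (0 < v <= (size t).+1)%N ->
  degree (attach t v) w =
    if w == (size t).+2 then 1%N else (degree t w + (w == v))%N.
Proof.
move=> tree_t v_t; rewrite degree_cons /=.
have [->|w_new] := eqVneq w (size t).+2.
  by rewrite orbT degree_outside //; lia.
by rewrite orbF addnC [v == w]eq_sym.
Qed.

(** The new vertex is a leaf and contributes nothing for k >= 2; its parent enters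
    the sum with its whole degree k when it had degree k - 1, and with one more
    unit when it already was in the sum. *)
Lemma heavy_attach k t v :
  recursive_tree t -> (0 < v <= (size t).+1)%N -> (1 < k)%N ->
  heavy k (attach t v) =
    (heavy k t + (if k <= degree t v then 1 else
                  if k.-1 <= degree t v then k else 0))%N.
Proof.
move=> tree_t v_t k_gt1; rewrite /heavy /= big_mkcond big_ord_recr /=.
rewrite degree_attach // eqxx leqNgt k_gt1 addn0 /=.
have lt_v : (v < (size t).+2)%N by lia.
rewrite (bigD1 (Ordinal lt_v)) //=.
rewrite [in RHS]big_mkcond [in RHS](bigD1 (Ordinal lt_v)) //=.
rewrite degree_attach // eqxx (_ : (v == (size t).+2) = false); last by lia.
rewrite (eq_bigr (fun i : 'I__ => if (k <= degree t i)%N then degree t i else 0%N)).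
  by move: (\sum_(i < _ | _) _)%N => r; do !case: ifP; lia.
move=> i /negPf i_v; rewrite degree_attach //.
rewrite (_ : (_ == v) = false) ?addn0; last exact: i_v.
by rewrite (_ : (_ == _) = false) //; have := ltn_ord i; lia.
Qed.

Lemma leq_heavy k l t : (k <= l)%N -> (heavy l t <= heavy k t)%N.
Proof.
move=> kl; rewrite /heavy [leqLHS]big_mkcond [leqRHS]big_mkcond leq_sum // => v _.
by case: ifP => // /(leq_trans kl) ->.
Qed.

Lemma sum_degree t :
  recursive_tree t -> (\sum_(v < (size t).+2) degree t v = 2 * size t)%N.
Proof.
elim: t => [_|[x y] t IHt] /=.
  by rewrite muln0 big1.
case/and3P => /= x_t /eqP -> tree_t; rewrite -/(attach t x) big_ord_recr /=.
rewrite degree_attach // eqxx.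
under eq_bigr => v _.
  rewrite degree_attach // ifN ?neq_ltn ?ltn_ord //.
  over.
rewrite big_split /= IHt // -(big_mkord xpredT (fun v => (v == x) : nat)).
rewrite (bigD1_seq x) ?iota_uniq ?mem_index_iota ?eqxx //.
  by rewrite big1 => [|i /negPf -> //]; rewrite /=; lia.
by apply/andP; split => //; case/andP: x_t.
Qed.

Lemma heavy1 t : recursive_tree t -> heavy 1 t = (2 * size t)%N.
Proof.
move=> tree_t; rewrite -sum_degree // /heavy big_mkcond; apply: eq_bigr => v _.
by case: (degree t v).
Qed.

Lemma degree_min_choice t x y b :
  degree t (min_choice t x y b) = minn (degree t x) (degree t y).
Proof. by rewrite /min_choice; case: ltngtP => // e; case: b. Qed.

Section OneStep.
Variable R : realType.
Implicit Types (f g : ltree -> R) (t : ltree).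

(** One step of the chain, integrated over the two choices and the coin. *)
Definition mean_step f t : R :=
  \sum_(x < (size t).+2) \sum_(y < (size t).+2) \sum_(b : bool)
    deg_prob R t x * deg_prob R t y * 2^-1 * f (attach t (min_choice t x y b)).

Lemma deg_prob_ge0 t v : 0 <= deg_prob R t v.
Proof. by rewrite divr_ge0. Qed.

Lemma deg_prob_outside t v :
  recursive_tree t -> ~~ (0 < v <= (size t).+1)%N -> deg_prob R t v = 0.
Proof. by move=> tree_t out; rewrite /deg_prob degree_outside ?mul0r. Qed.

(** Choices outside the tree have weight 0, so it is enough to compare f and g
    after an attachment to a vertex; this keeps the chain among recursive
    trees. *)
Lemma mean_step_le f g t : recursive_tree t ->
  (forall v, (0 < v <= (size t).+1)%N -> f (attach t v) <= g (attach t v)) ->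
  mean_step f t <= mean_step g t.
Proof.
move=> tree_t le_fg; apply: ler_sum => x _; apply: ler_sum => y _.
apply: ler_sum => b _.
have [x_t|out] := boolP (0 < x <= (size t).+1)%N; last first.
  by rewrite [deg_prob R t x]deg_prob_outside // !mul0r.
have [y_t|out] := boolP (0 < y <= (size t).+1)%N; last first.
  by rewrite [deg_prob R t y]deg_prob_outside // !mulr0 !mul0r.
rewrite ler_wpM2l ?mulr_ge0 ?deg_prob_ge0 ?invr_ge0 //.
by apply: le_fg; rewrite /min_choice; do !case: ifP.
Qed.

Lemma mean_stepD f g t :
  mean_step (fun u => f u + g u) t = mean_step f t + mean_step g t.
Proof.
rewrite -big_split; apply: eq_bigr => x _ /=; rewrite -big_split.
apply: eq_bigr => y _ /=; rewrite -big_split; apply: eq_bigr => b _ /=.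
by rewrite mulrDr.
Qed.

Lemma mean_stepZ (c : R) f t :
  mean_step (fun u => c * f u) t = c * mean_step f t.
Proof.
rewrite mulr_sumr; apply: eq_bigr => x _; rewrite mulr_sumr.
apply: eq_bigr => y _; rewrite mulr_sumr; apply: eq_bigr => b _.
by rewrite mulrCA.
Qed.

Definition last_parent (t : ltree) : nat := (head (0%N, 0%N) t).1.

Definition heavy_prob k t : R := (heavy k t)%:R / (2 * size t)%N%:R.

Lemma sum_deg_prob k t :
  \sum_(x < (size t).+2) deg_prob R t x * (k <= degree t x)%N%:R =
  heavy_prob k t.
Proof.
rewrite /heavy_prob /heavy natr_sum mulr_suml [RHS]big_mkcond.
by apply: eq_bigr => x _; case: ifP; rewrite ?mulr1 ?mulr0.
Qed.

(** The smaller of two degrees is at least k when both are, and the two choices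
    are independent: this square is the power of two choices. *)
Lemma mean_step_heavy k t :
  mean_step (fun u => (k <= degree t (last_parent u))%N%:R) t =
  heavy_prob k t ^+ 2.
Proof.
rewrite expr2 -sum_deg_prob mulr_suml; apply: eq_bigr => x _.
rewrite mulr_sumr; apply: eq_bigr => y _; rewrite big_bool /=.
rewrite !degree_min_choice leq_min.
by case: (_ <= degree t x)%N; case: (_ <= degree t y)%N => /=; lra.
Qed.

Lemma heavy_prob0 t : recursive_tree t -> (0 < size t)%N -> heavy_prob 0 t = 1.
Proof.
move=> tree_t t_gt0; rewrite /heavy_prob /heavy sum_degree // divff //.
by rewrite pnatr_eq0; lia.
Qed.

Lemma mean_step_cst (c : R) t :
  recursive_tree t -> (0 < size t)%N -> mean_step (fun=> c) t = c.
Proof.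
move=> tree_t t_gt0.
have := mean_stepZ c (fun u => (0 <= degree t (last_parent u))%N%:R) t.
by rewrite mean_step_heavy heavy_prob0 // expr1n mulr1.
Qed.

End OneStep.

(** * Expectations along the chain, and properties of the whole past *)

(** The tails of a tree being its past, this says that Q has held at every time
    since the first edge. *)
Fixpoint always (Q : pred ltree) (t : ltree) : bool :=
  if t is e :: u then Q t && always Q u else true.

Lemma always_cons Q e t : always Q (e :: t) -> always Q t.
Proof. by case/andP. Qed.

Section Mean.
Variable R : realType.
Implicit Types (f g : ltree -> R) (t : ltree) (A B Q : pred ltree).

Lemma iter_mean_step_le n f g t : recursive_tree t ->
  (forall u, recursive_tree u -> size u = (size t + n)%N -> f u <= g u) ->
  iter n (@mean_step R) f t <= iter n (@mean_step R) g t.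
Proof.
elim: n t => [|n IHn] t tree_t le_fg /=.
  by apply: le_fg => //; rewrite addn0.
apply: mean_step_le => // v v_t; apply: IHn.
  exact: recursive_tree_attach.
by move=> u tree_u su; apply: le_fg; rewrite // su /= addSnnS.
Qed.

(** The expectation over the tree with n edges, for n >= 1. *)
Definition mean (n : nat) f : R :=
  iter n.-1 (@mean_step R) f [:: (1%N, 2%N)].

Lemma mean_le n f g : (0 < n)%N ->
  (forall t, recursive_tree t -> size t = n -> f t <= g t) ->
  mean n f <= mean n g.
Proof.
move=> n_gt0 le_fg; apply: iter_mean_step_le => // u tree_u /= su.
by apply: le_fg; rewrite // su add1n prednK.
Qed.

Lemma eq_mean n f g : (0 < n)%N ->
  (forall t, recursive_tree t -> size t = n -> f t = g t) ->
  mean n f = mean n g.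
Proof.
by move=> n_gt0 e; apply/eqP; rewrite eq_le !mean_le // => t tt st; rewrite e.
Qed.

(** The forward equation, whereas [mean] iterates the backward one. *)
Lemma meanS n f : (0 < n)%N -> mean n.+1 f = mean n (@mean_step R f).
Proof. by case: n => // n _; rewrite /mean /= -iterS iterSr. Qed.

Lemma meanD n f g : mean n (fun t => f t + g t) = mean n f + mean n g.
Proof.
rewrite /mean; elim: n.-1 [:: _] => [//|j IHj] t /=.
rewrite -mean_stepD; apply: eq_bigr => x _; apply: eq_bigr => y _.
by apply: eq_bigr => b _; rewrite IHj.
Qed.

Lemma meanZ n (c : R) f : mean n (fun t => c * f t) = c * mean n f.
Proof.
rewrite /mean; elim: n.-1 [:: _] => [//|j IHj] t /=.
rewrite -mean_stepZ; apply: eq_bigr => x _; apply: eq_bigr => y _.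
by apply: eq_bigr => b _; rewrite IHj.
Qed.

Lemma mean_cst n (c : R) : (0 < n)%N -> mean n (fun=> c) = c.
Proof.
elim: n => [//|[_ _ //|n IHn _]]; rewrite meanS // -[RHS]IHn //.
by apply: eq_mean => // t tree_t st; rewrite mean_step_cst // st.
Qed.

Lemma mean_ge0 n f : (0 < n)%N ->
  (forall t, recursive_tree t -> size t = n -> 0 <= f t) -> 0 <= mean n f.
Proof. by move=> n_gt0 f_ge0; rewrite -(@mean_cst n 0) // mean_le. Qed.

Lemma mean_step_behead f t : recursive_tree t -> (0 < size t)%N ->
  mean_step (fun u => f (behead u)) t = f t.
Proof. by move=> tt st; rewrite -[RHS](@mean_step_cst R _ t). Qed.

Definition prob (n : nat) A : R := mean n (fun t => (A t)%:R).

Lemma prob_le n A B : (0 < n)%N ->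
  (forall t, recursive_tree t -> size t = n -> A t -> B t) ->
  prob n A <= prob n B.
Proof.
move=> n_gt0 AB; apply: mean_le => // t tree_t st; rewrite ler_nat.
by have := AB t tree_t st; case: (A t) => // ->.
Qed.

Lemma prob_ge0 n A : (0 < n)%N -> 0 <= prob n A.
Proof. by move=> n_gt0; apply: mean_ge0. Qed.

Lemma prob_or n A B : (0 < n)%N ->
  prob n (fun t => A t || B t) <= prob n A + prob n B.
Proof.
move=> n_gt0; rewrite /prob -meanD; apply: mean_le => // t _ _.
by rewrite -natrD ler_nat; case: (A t); case: (B t).
Qed.

Lemma prob_leU n A B C : (0 < n)%N ->
  (forall t, recursive_tree t -> size t = n -> A t -> B t || C t) ->
  prob n A <= prob n B + prob n C.
Proof.
by move=> n_gt0 ABC; apply: le_trans (prob_or B C n_gt0); apply: prob_le.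
Qed.

Lemma probC n A : (0 < n)%N -> prob n A + prob n (fun t => ~~ A t) = 1.
Proof.
move=> n_gt0; rewrite /prob -meanD -[RHS](@mean_cst n) //; apply: eq_mean => //.
by move=> t _ _; case: (A t); rewrite ?addr0 ?add0r.
Qed.

Lemma prob_behead n A : (0 < n)%N ->
  prob n.+1 (fun t => A (behead t)) = prob n A.
Proof.
move=> n_gt0; rewrite /prob meanS //; apply: eq_mean => // t tree_t st.
by rewrite (mean_step_behead (fun u => (A u)%:R)) // st.
Qed.

(** A union bound over the first time at which Q fails: at that time, the
    requirement A on the whole past is still satisfied, so each term may use
    it. *)
Lemma prob_not_always A Q n :
  (forall e t, A (e :: t) -> A t) -> (0 < n)%N ->
  prob n (fun t => A t && ~~ always Q t) <=
  \sum_(1 <= j < n.+1) prob j (fun t => A t && ~~ Q t).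
Proof.
move=> A_cons; elim: n => // -[_ _|n IHn _].
  rewrite big_nat1; apply: prob_le => // -[|e [|]] //= _ _.
  by rewrite andbT.
rewrite -(prob_behead _ (ltn0Sn n)) in IHn.
rewrite big_nat_recr //=.
apply: le_trans (lerD (IHn isT) (lexx _)).
apply: prob_leU => // -[//|e t] _ _ /=; rewrite negb_and.
by case/andP=> At /orP[nQ|nQ]; rewrite ?(A_cons _ _ At) ?At ?nQ ?orbT.
Qed.

End Mean.

(** * From one degree level to the next *)

Section Level.
Variable R : realType.
Implicit Types (t : ltree) (H : pred ltree) (x : R).

(** Square the bound exp (x/2) <= 1 / (1 - x/2). *)
Lemma expR_le_quadratic x : 0 <= x <= 3^-1 -> expR x <= 1 + x + x ^+ 2.
Proof.
move=> x_int; have e_half : expR x = expR (x / 2) ^+ 2.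
  by rewrite expr2 -expRD -splitr.
have : expR (x / 2) * (1 - x / 2) <= 1.
  rewrite -[leRHS]expR0 -(subrr (x / 2)) expRD ler_pM2l ?expR_gt0 //.
  exact: expR_ge1Dx.
rewrite e_half; have := expR_gt0 (x / 2); set e := expR _ => e_gt0 e_le.
have : (e * (1 - x / 2)) ^+ 2 <= 1 by rewrite expr_le1 // mulr_ge0 //; lra.
rewrite exprMn => e2.
have : 1 <= (1 + x + x ^+ 2) * (1 - x / 2) ^+ 2.
  have -> : (1 + x + x ^+ 2) * (1 - x / 2) ^+ 2 =
    1 + x ^+ 2 / 4 * (1 - 3 * x + x ^+ 2) by field.
  rewrite lerDl mulr_ge0 ?divr_ge0 ?sqr_ge0 //; nra.
move=> /(le_trans e2); rewrite ler_pM2r // exprn_gt0 //; lra.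
Qed.

Lemma expRN_le_linear x : 0 <= x <= 1 -> expR (- x) <= 1 - x / 2.
Proof.
move=> x_int; rewrite expRN -[leRHS]invrK lef_pV2 ?posrE ?expR_gt0 //; last first.
  by rewrite invr_gt0; lra.
apply: le_trans (expR_ge1Dx x); rewrite -[leLHS]mulr1 ler_pdivrMl; nra.
Qed.

(** A geometric series, of sum 1 / (exp x - 1). *)
Lemma sum_expR_le x n : 0 < x ->
  \sum_(1 <= j < n.+1) expR (- (x * j%:R)) <= x^-1.
Proof.
move=> x_gt0; suff : \sum_(1 <= j < n.+1) expR (- (x * j%:R)) <=
    x^-1 * (1 - expR (- (x * n%:R))).
  move=> /le_trans; apply; rewrite -[leRHS]mulr1 ler_pM2l ?invr_gt0 //.
elim: n => [|n IHn]; first by rewrite big_geq // mulr0 oppr0 expR0 subrr mulr0.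
rewrite big_nat_recr //=; apply: le_trans (lerD IHn (lexx _)) _.
have -> : - (x * n%:R) = - (x * n.+1%:R) + x by rewrite -(natr1 n); ring.
rewrite expRD; have := expR_gt0 (- (x * n.+1%:R)); set e := expR (- _) => e_gt0.
have := expR_ge1Dx x; set f := expR x => f_ge.
rewrite -(ler_pM2l x_gt0) mulrDr !mulVKf ?gt_eqF //; nra.
Qed.

(** The last bracket is the mean increment of E_k; as an increment is at most k,
    the second-order term of the exponential costs a factor 1 + c k only. *)
Lemma mean_step_expR_heavy k (c : R) t :
  recursive_tree t -> (0 < size t)%N -> (1 < k)%N ->
  0 <= c -> c * k%:R <= 3^-1 ->
  mean_step (fun u => expR (c * (heavy k u)%:R)) t <=
  expR (c * (heavy k t)%:R) *
    (1 + c * (1 + c * k%:R) * (k%:R * heavy_prob R k.-1 t ^+ 2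
                               - k.-1%:R * heavy_prob R k t ^+ 2)).
Proof.
move=> tree_t t_gt0 k_gt1 c_ge0 ck_le.
set h := expR _; set a := c * (1 + c * k%:R).
pose ge_k j u : R := (j <= degree t (last_parent u))%N%:R.
apply: (@le_trans _ _ (mean_step (fun u : ltree =>
  h * (1 + a * (k%:R * ge_k k.-1 u + (- k.-1%:R) * ge_k k u))) t)).
  apply: mean_step_le => // v v_t; rewrite heavy_attach // natrD mulrDr expRD.
  rewrite /h ler_pM2l ?expR_gt0 // /ge_k /last_parent /=.
  set i := (if (k <= _)%N then _ else _).
  have [i_le ->] : (i <= k)%N /\ k%:R * (k.-1 <= degree t v)%N%:R +
      - k.-1%:R * (k <= degree t v)%N%:R = i%:R :> R.
    rewrite /i; case: ifP => [k_v|_].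
      rewrite (_ : (k.-1 <= _)%N = true); last by lia.
      by split; [lia|rewrite !mulr1 -[in k%:R](prednK (ltnW k_gt1)) -natr1; ring].
    by case: ifP; split; rewrite ?mulr1 ?mulr0 ?addr0.
  have i_leR : (i%:R <= k%:R :> R) by rewrite ler_nat.
  have i_ge0 : (0 <= i%:R :> R) by [].
  have ci_le : c * i%:R <= c * k%:R by rewrite ler_wpM2l.
  have := mulr_ge0 c_ge0 i_ge0 => ci_ge0.
  apply: le_trans (expR_le_quadratic _) _; first by rewrite ci_ge0 /=; lra.
  rewrite /a -addrA lerD2l; nra.
rewrite mean_stepZ mean_stepD mean_stepZ mean_stepD !mean_stepZ.
by rewrite mean_step_cst // /ge_k !mean_step_heavy mulNr.
Qed.

Lemma heavy_probE k t : (0 < size t)%N ->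
  (heavy k t)%:R = heavy_prob R k t * 2 * (size t)%:R.
Proof.
move=> t_gt0; rewrite /heavy_prob natrM -mulrA divfK //.
by rewrite -natrM pnatr_eq0; lia.
Qed.

Lemma heavy_prob_ge0 k t : 0 <= heavy_prob R k t.
Proof. by rewrite divr_ge0. Qed.

(** The setting of the induction step on levels.  H is a property of the whole
    past that bounds the density p_(k-1) by a from time s on.  [drift] is the
    drift condition for the line of slope 2b at level k: where E_k is above this
    line, its mean increment is at most 2b - eta.  The exponent c is small
    enough for the exponential moment with parameter c to feel this drift in
    spite of the second-order terms. *)
Section OneLevel.
Variables (k s : nat) (a b eta c : R) (H : pred ltree).
Hypotheses (k_gt1 : (1 < k)%N) (s_gt0 : (0 < s)%N).
Hypotheses (a_gt0 : 0 < a) (b_gt0 : 0 < b) (c_gt0 : 0 < c).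
Hypotheses (eta_gt0 : 0 < eta) (eta_le : eta <= 2 * b) (eta_le1 : eta <= 1).
Hypothesis drift : k%:R * a ^+ 2 + eta <= 2 * b + k.-1%:R * b ^+ 2.
Hypotheses (c_small : c * k%:R <= 3^-1) (c_small_b : c * k%:R * (2 * b) <= eta / 2).
Hypothesis H_cons : forall e t, H (e :: t) -> H t.
Hypothesis H_heavy : forall t, recursive_tree t -> H t -> (s <= size t)%N ->
  heavy_prob R k.-1 t <= a.

(** The exponential moment of the excess of E_k over the line of slope 2b. *)
Let excess t : R := expR (c * ((heavy k t)%:R - 2 * b * (size t)%:R)).

(** Above the line, the drift makes the excess contract by a constant factor;
    below it, one step overshoots by at most k, which adds at most
    exp (c k) <= 2. *)
Lemma mean_step_excess t : recursive_tree t -> (0 < size t)%N ->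
  heavy_prob R k.-1 t <= a ->
  mean_step excess t <= expR (- (c * eta / 2)) * excess t + 2.
Proof.
move=> tree_t t_gt0 p_le.
(* E_k = 2 n p_k, so p_k < b means that the tree is below the line. *)
have [p_b|b_p] := ltP (heavy_prob R k t) b.
  apply: (@le_trans _ _ (mean_step (fun=> 2) t)); last first.
    by rewrite mean_step_cst // lerDr mulr_ge0 ?expR_ge0.
  apply: mean_step_le => // v v_t; apply: (@le_trans _ _ (expR (c * k%:R))).
    rewrite /excess ler_expR; apply: ler_wpM2l; first exact: ltW.
    rewrite lerBlDr.
    have h_le : (heavy k (attach t v) <= k + heavy k t)%N.
      by rewrite heavy_attach //; do !case: ifP; lia.
    have : (heavy k (attach t v))%:R <= k%:R + (heavy k t)%:R :> R.
      by rewrite -natrD ler_nat.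
    move=> /le_trans; apply; rewrite lerD2l heavy_probE //= -(natr1 (size t)).
    have : (0 : R) < (size t)%:R by rewrite ltr0n.
    move: (heavy_prob R k t) (size t)%:R p_b => p x /ltW p_b /ltW x_ge0.
    by have := b_gt0; have := ler_wpM2r x_ge0 p_b; lra.
  have ck_ge0 : 0 <= c * k%:R by rewrite mulr_ge0 // ltW.
  apply: le_trans (expR_le_quadratic _) _; first by rewrite ck_ge0 c_small.
  by have := c_small; nra.
have ck_ge0 : 0 <= c * k%:R by rewrite mulr_ge0 // ltW.
apply: (@le_trans _ _ (expR (- (c * (2 * b) * (size t).+1%:R)) *
    mean_step (fun u => expR (c * (heavy k u)%:R)) t)).
  rewrite -mean_stepZ; apply: mean_step_le => // v v_t.
  by rewrite /excess -expRD ler_expR /=; lra.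
apply: (@le_trans _ _ (expR (- (c * eta / 2)) * excess t)); last by rewrite lerDl.
apply: le_trans (ler_wpM2l (expR_ge0 _) (mean_step_expR_heavy _ _ _ _ _)) _ => //.
  exact: ltW.
rewrite [leLHS]mulrA -!expRD.
apply: le_trans (ler_wpM2l (expR_ge0 _) (expR_ge1Dx _)) _.
rewrite -!expRD ler_expR -(natr1 (size t)).
set p := heavy_prob R k t in b_p *; set q := heavy_prob R k.-1 t in p_le *.
have q_ge0 : 0 <= q by exact: heavy_prob_ge0.
have drift_t : k%:R * q ^+ 2 - k.-1%:R * p ^+ 2 <= 2 * b - eta.
  have q2 : k%:R * q ^+ 2 <= k%:R * a ^+ 2.
    by rewrite ler_wpM2l // ler_sqr ?nnegrE // ltW.
  have : k.-1%:R * b ^+ 2 <= k.-1%:R * p ^+ 2.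
    by rewrite ler_wpM2l // ler_sqr ?nnegrE ?(le_trans (ltW b_gt0)) // ltW.
  by have := drift; lra.
have step1 : (1 + c * k%:R) * (k%:R * q ^+ 2 - k.-1%:R * p ^+ 2) <=
    2 * b - eta / 2.
  apply: (@le_trans _ _ ((1 + c * k%:R) * (2 * b - eta))).
    by rewrite ler_wpM2l //; lra.
  by have := c_small_b; have := mulr_ge0 ck_ge0 (ltW eta_gt0); lra.
have := ler_wpM2l (ltW c_gt0) step1.
move: (k%:R * q ^+ 2 - _) => z; move: ((heavy k t)%:R) ((size t)%:R) => X Y.
by lra.
Qed.

Lemma c_eta_le_half : c * eta <= 2^-1.
Proof.
have k_ge2 : (2 : R) <= k%:R by rewrite ler_nat.
have := ler_wpM2l (ltW c_gt0) k_ge2; have := ler_wpM2l (ltW c_gt0) eta_le1.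
by have := c_small; lra.
Qed.

(** The affine recursion W -> rho W + 2 with 1 - rho >= c eta / 4 cannot leave
    the interval below any bound that is at least 8 / (c eta).  At time s, the
    excess is controlled by E_k <= E_(k-1) <= 2 a s; this is much better than
    the trivial bound 2 s, and the doubly exponential regime depends on it. *)
Lemma mean_excess n : (s <= n)%N ->
  mean n (fun t => (H t)%:R * excess t) <=
  expR (2 * c * a * s%:R) + 8 / (c * eta).
Proof.
have ceta_gt0 : 0 < c * eta by rewrite mulr_gt0.
move=> s_n; have n_gt0 := leq_trans s_gt0 s_n.
elim: n s_n n_gt0 => [//|n IHn] s_n _.
have [lt_sn|{}s_n] := ltnP n s.
  have -> : s = n.+1 by lia.
  apply: (@le_trans _ _ (mean n.+1 (fun=> expR (2 * c * a * n.+1%:R)))).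
    apply: mean_le => // t tree_t st.
    have [Ht|_] := boolP (H t); last by rewrite mul0r expR_ge0.
    rewrite mul1r ler_expR st.
    have : (heavy k t)%:R <= 2 * a * n.+1%:R :> R.
      apply: (@le_trans _ _ (heavy k.-1 t)%:R).
        by rewrite ler_nat leq_heavy // leq_pred.
      rewrite heavy_probE ?st //.
      have := H_heavy tree_t Ht; rewrite st => /(_ s_n) pa.
      by have := ler_wpM2r (ler0n R n.+1) pa; lra.
    move=> h_le; have bn_ge0 := mulr_ge0 (ltW b_gt0) (ler0n R n.+1).
    have := ler_wpM2l (ltW c_gt0) h_le.
    have := mulr_ge0 (ltW c_gt0) bn_ge0; lra.
  by rewrite mean_cst // lerDl divr_ge0 // ltW.
have n_gt0 := leq_trans s_gt0 s_n.
rewrite meanS //.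
apply: (@le_trans _ _ (mean n (fun t =>
   expR (- (c * eta / 2)) * ((H t)%:R * excess t) + 2))).
  apply: mean_le => // t tree_t st.
  apply: (@le_trans _ _ ((H t)%:R * mean_step excess t)).
    rewrite -mean_stepZ; apply: mean_step_le => // v v_t.
    rewrite ler_wpM2r ?expR_ge0 // ler_nat.
    by have := @H_cons (v, (size t).+2) t; rewrite /attach; do 2!case: (H _) => // ->.
  have [Ht|_] := boolP (H t); last by rewrite !mul0r mulr0 add0r.
  by rewrite !mul1r mean_step_excess ?st // H_heavy // st.
rewrite meanD meanZ mean_cst //; have := IHn s_n n_gt0.
have M_ge : 8 / (c * eta) <= expR (2 * c * a * s%:R) + 8 / (c * eta).
  by rewrite lerDr expR_ge0.
have : 8 <= c * eta * (expR (2 * c * a * s%:R) + 8 / (c * eta)).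
  by rewrite -ler_pdivrMl // mulrC.
move: (expR _ + _) M_ge => M M_ge cM W_le.
have : c * eta / 2 <= 1.
  by have := c_eta_le_half; lra.
move=> ceta_le; have e_le : expR (- (c * eta / 2)) <= 1 - c * eta / 2 / 2.
  by apply: expRN_le_linear; rewrite ceta_le divr_ge0 ?ltW.
apply: le_trans (lerD (ler_wpM2l (expR_ge0 _) W_le) (lexx 2)) _.
have M_ge0 : 0 <= M by apply: le_trans M_ge; rewrite divr_ge0 // ltW.
have := ler_wpM2r M_ge0 e_le; lra.
Qed.

(** A line of slope larger than 2b by 2 eta, so that failure at time j costs
    exp (- 2 c eta j), which is summable; its intercept is twice the initial
    value 2 a s. *)
Definition level_bound t :=
  (s <= size t)%N ==>
  ((heavy k t)%:R <= 2 * (b + eta) * (size t)%:R + 4 * a * s%:R).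

(** Markov's inequality for the exponential moment of the excess at each time,
    summed over all times with [prob_not_always]. *)
Lemma prob_level n : (0 < n)%N ->
  prob R n (fun t => H t && ~~ always level_bound t) <=
  5 / (c * eta) ^+ 2 * expR (- (2 * c * a * s%:R)).
Proof.
move=> n_gt0; apply: le_trans (prob_not_always _ _ _ _) _ => //.
have ceta_gt0 : 0 < c * eta by rewrite mulr_gt0.
pose M : R := expR (2 * c * a * s%:R) + 8 / (c * eta).
have M_gt0 : 0 < M by rewrite addr_gt0 ?expR_gt0 ?divr_gt0.
apply: (@le_trans _ _ (\sum_(1 <= j < n.+1)
  expR (- (2 * c * eta * j%:R)) * (expR (- (4 * c * a * s%:R)) * M))).
  rewrite !big_nat; apply: ler_sum => j /andP[j_gt0 _].
  have [lt_js|le_sj] := ltnP j s.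
    rewrite [leLHS](_ : _ = 0); last first.
      rewrite -(@mean_cst R j 0) //; apply: eq_mean => // t _ st.
      by rewrite /level_bound st leqNgt lt_js andbF.
    by rewrite !mulr_ge0 ?expR_ge0 // ltW.
  rewrite mulrA -expRD.
  apply: le_trans (ler_wpM2l (expR_ge0 _) (mean_excess le_sj)).
  rewrite /prob -meanZ; apply: mean_le => // t tree_t st.
  rewrite /level_bound st le_sj /= -ltNge.
  case: (H t) => /=; last by rewrite mul0r mulr0.
  rewrite mul1r -expRD; have [heavy_t|_] := ltP; last by rewrite expR_ge0.
  rewrite -[leLHS]expR0 ler_expR st; have := ler_wpM2l (ltW c_gt0) (ltW heavy_t).
  by lra.
rewrite -mulr_suml.
have two_gt0 : 0 < 2 * c * eta by rewrite -mulrA mulr_gt0.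
apply: le_trans (ler_wpM2r _ (sum_expR_le n two_gt0)) _.
  by rewrite mulr_ge0 ?expR_ge0 // ltW.
have -> : expR (- (4 * c * a * s%:R)) =
   expR (- (2 * c * a * s%:R)) * expR (- (2 * c * a * s%:R)).
  by rewrite -expRD; congr expR; ring.
set e := expR (- (2 * c * a * s%:R)).
have eM : e * M <= 9 / (c * eta).
  rewrite /M mulrDr /e -expRD addNr expR0.
  have e_le1 : e <= 1.
    by rewrite -[leRHS]expR0 ler_expR oppr_le0 !mulr_ge0 // ltW.
  have ceta_le1 : 1 <= (c * eta)^-1.
    rewrite -[leLHS]invr1 lef_pV2 ?posrE //.
    by have := c_eta_le_half; lra.
  have : e * (8 / (c * eta)) <= 8 / (c * eta).
    by rewrite ler_piMl // divr_ge0 // ltW.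
  by rewrite /e; lra.
have e_ge0 : 0 <= e by exact: expR_ge0.
have -> : 5 / (c * eta) ^+ 2 * e = (2 * c * eta)^-1 * (e * (10 / (c * eta))).
  by field; rewrite !gt_eqF.
rewrite ler_wpM2l ?invr_ge0 ?(ltW two_gt0) // -mulrA ler_wpM2l //.
by apply: le_trans eM _; rewrite ler_pM2r ?invr_gt0 // ler_nat.
Qed.

End OneLevel.
End Level.

(** * The first nine levels *)

Lemma always_imply (Q Q' : pred ltree) t :
  (forall e u, recursive_tree (e :: u) -> Q (e :: u) -> Q' (e :: u)) ->
  recursive_tree t -> always Q t -> always Q' t.
Proof.
move=> QQ'; elim: t => // e t IHt tree_t /andP[Qt At].
by rewrite /= QQ' // IHt //; case/and3P: tree_t.
Qed.

Section Soft.
Variable R : realType.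
Implicit Types (t : ltree) (a b eta eps x : R).

(** From time s on, the density at level k is at most a. *)
Definition light k a s t : bool := (s <= size t)%N ==> (heavy_prob R k t <= a).

Lemma always_light k a s t : (0 < s <= size t)%N -> always (light k a s) t ->
  heavy_prob R k t <= a.
case: t => [|e t] /andP[s_gt0 s_t]; first by case: s s_gt0 s_t.
by case/andP => /implyP ->.
Qed.

(** The same bound holds at all times after s with probability close to 1,
    uniformly in the horizon n. *)
Definition eventually_light k a : Prop := forall eps, 0 < eps ->
  exists2 s, (0 < s)%N & forall n, (0 < n)%N ->
    prob R n (fun t => ~~ always (light k a s) t) <= eps.

Lemma always_light_leq k a s s' t : (s <= s')%N -> recursive_tree t ->
  always (light k a s) t -> always (light k a s') t.
Proof.
move=> le_s tree_t; apply: always_imply tree_t => e u _ /implyP light_u.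
by apply/implyP => /(leq_trans le_s)/light_u.
Qed.

Lemma exists_nat_ge x : exists2 s, (0 < s)%N & x <= s%:R.
Proof.
exists (Num.bound `|x|).+1 => //.
have := archi_boundP (normr_ge0 x); have := ler_norm x.
rewrite -natr1; lra.
Qed.

Lemma expRN_le_inv x : 0 < x -> expR (- x) <= x^-1.
Proof.
move=> x_gt0; rewrite expRN lef_pV2 ?posrE ?expR_gt0 //.
by apply: le_trans (expR_ge1Dx x); lra.
Qed.

Lemma eventually_light1 : eventually_light 1 1.
Proof.
move=> eps eps_gt0; exists 1%N => // n n_gt0.
rewrite [leLHS](_ : _ = 0) ?ltW // -(@mean_cst R n 0) //.
apply: eq_mean => // t tree_t _.
suff -> : always (light 1 1 1) t by [].
elim: t tree_t => // e t IHt tree_t /=; rewrite IHt ?andbT; last first.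
  by case/and3P: tree_t.
by rewrite /light /heavy_prob heavy1 //= divff // pnatr_eq0.
Qed.

Lemma eventually_light_weaken k a b : a <= b ->
  eventually_light k a -> eventually_light k b.
Proof.
move=> le_ab ev eps /ev[s s_gt0 le_eps]; exists s => // n n_gt0.
apply: le_trans (le_eps n n_gt0); apply: prob_le => // t tree_t _.
apply: contra; apply: always_imply tree_t => e u _ /implyP light_u.
by apply/implyP => /light_u/le_trans; apply.
Qed.

Lemma eventually_lightS k a b eta : (1 < k)%N ->
  0 < a -> 0 < b -> 0 < eta -> eta <= 2 * b -> eta <= 1 ->
  k%:R * a ^+ 2 + eta <= 2 * b + k.-1%:R * b ^+ 2 ->
  eventually_light k.-1 a -> eventually_light k (b + 2 * eta).
Proof.
move=> k_gt1 a_gt0 b_gt0 eta_gt0 eta_le eta_le1 drift ev eps eps_gt0.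
(* The factor 1 + b makes both smallness conditions on c hold, whether b is
   large or small. *)
pose c : R := eta / (4 * k%:R * (1 + b)).
have k_gt0 : (0 : R) < k%:R by rewrite ltr0n; lia.
have b1_gt0 : 0 < 1 + b by rewrite addr_gt0.
have c_gt0 : 0 < c by rewrite divr_gt0 ?mulr_gt0.
have ck : c * k%:R = eta / (4 * (1 + b)).
  by rewrite /c; field; rewrite !gt_eqF.
have c_small : c * k%:R <= 3^-1.
  rewrite ck ler_pdivrMr ?mulr_gt0 //; lra.
have c_small_b : c * k%:R * (2 * b) <= eta / 2.
  have -> : c * k%:R * (2 * b) = eta / 2 * (b / (1 + b)).
    by rewrite ck; field; rewrite !gt_eqF.
  by rewrite ler_piMr ?divr_ge0 ?ltW // ltr_pdivrMr // mul1r ltrDr.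
have eps2_gt0 : 0 < eps / 2 by rewrite divr_gt0.
have [s0 s0_gt0 ev_s0] := ev _ eps2_gt0.
have ceta_gt0 : 0 < c * eta by rewrite mulr_gt0.
have ca_gt0 : 0 < 2 * c * a by rewrite 2?mulr_gt0.
pose B : R := 5 / (c * eta) ^+ 2.
have B_gt0 : 0 < B by rewrite divr_gt0 ?exprn_gt0.
have [s1 s1_gt0 s1_ge] := exists_nat_ge (B / (2 * c * a) / (eps / 2)).
pose s := (s0 + s1)%N.
(* After time s2 the intercept 4 a s of the line is absorbed by one more eta of
   slope. *)
have [s2 s2_gt0 s2_ge] := exists_nat_ge (4 * a * s%:R / (2 * eta)).
have s_gt0 : (0 < s)%N by rewrite addn_gt0 s0_gt0.
exists (s + s2)%N => [|n n_gt0]; first by rewrite addn_gt0 s_gt0.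
pose H := always (light k.-1 a s).
have H_heavy t : recursive_tree t -> H t -> (s <= size t)%N ->
    heavy_prob R k.-1 t <= a.
  by move=> _ Ht s_t; apply: always_light Ht; rewrite s_gt0.
have H_cons e t : H (e :: t) -> H t by exact: always_cons.
rewrite [leRHS]splitr.
apply: (@le_trans _ _ (prob R n (fun t => ~~ H t) +
    prob R n (fun t => H t && ~~ always (level_bound k s a b eta) t))).
  apply: prob_leU => // t tree_t st notlight.
  have [Ht|//] := boolP (H t); apply: contra notlight => /=.
  apply: always_imply tree_t => e u tree_u; rewrite /level_bound => /implyP bd.
  apply/implyP => le_s.
  rewrite /heavy_prob ler_pdivrMr ?ltr0n //.
  apply: le_trans (bd _) _; first by apply: leq_trans le_s; rewrite leq_addr.
  rewrite natrM; move: le_s; set z := size _ => le_s.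
  have s2_z : s2%:R <= z%:R :> R by rewrite ler_nat; apply: leq_trans le_s; rewrite leq_addl.
  move: s2_ge; rewrite ler_pdivrMr ?mulr_gt0 // => s2_ge.
  have := ler_wpM2r (ltW (mulr_gt0 (ltr0Sn R 1) eta_gt0)) s2_z; lra.
apply: lerD.
  apply: le_trans (ev_s0 n n_gt0); apply: prob_le => // t tree_t _.
  by apply: contra; apply: always_light_leq; rewrite ?leq_addr.
apply: le_trans (prob_level k_gt1 s_gt0 a_gt0 b_gt0 c_gt0 eta_gt0 eta_le eta_le1
  drift c_small c_small_b H_cons H_heavy n_gt0) _.
have cas_gt0 : 0 < 2 * c * a * s%:R by rewrite mulr_gt0 ?ltr0n.
apply: le_trans (ler_wpM2l (ltW B_gt0) (expRN_le_inv cas_gt0)) _.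
have s1_s : s1%:R <= s%:R :> R by rewrite ler_nat leq_addl.
rewrite (ler_pdivrMr _ _ cas_gt0).
move: s1_ge; rewrite (ler_pdivrMr _ _ eps2_gt0) (ler_pdivrMr _ _ ca_gt0) => s1_ge.
apply: (le_trans s1_ge).
have := ler_wpM2r (ltW (mulr_gt0 eps2_gt0 ca_gt0)) s1_s; lra.
Qed.

(** The fixed points of k a^2 = 2 b + (k-1) b^2 started at p_1 = 1 are about
    0.732, 0.526, 0.36, 0.22, 0.12, ... ; the explicit bounds below leave some
    room at each level.  At level 9 the density is small enough for the crude
    recursion b = k a^2 to take over. *)
Lemma eventually_light9 : eventually_light 9 (1 / 72).
Proof.
have step k (a b : R) : (0 < k)%N -> 0 < a -> 0 < b -> 1 / 1000 <= b ->
    k.+1%:R * a ^+ 2 + 1 / 1000 <= 2 * b + k%:R * b ^+ 2 ->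
    eventually_light k a -> eventually_light k.+1 (b + 1 / 500).
  move=> k_gt0 a_gt0 b_gt0 b_ge drift ev.
  have -> : 1 / 500 = 2 * (1 / 1000) :> R by lra.
  by apply: (@eventually_lightS k.+1 a b (1 / 1000) k_gt0 a_gt0 b_gt0 _ _ _ _ ev); lra.
have l2 : eventually_light 2 (74 / 100).
  by apply: eventually_light_weaken
    (step 1%N 1 (735 / 1000) isT _ _ _ _ eventually_light1); lra.
have l3 : eventually_light 3 (55 / 100).
  by apply: eventually_light_weaken
    (step 2%N _ (545 / 1000) isT _ _ _ _ l2); lra.
have l4 : eventually_light 4 (4 / 10).
  by apply: eventually_light_weaken
    (step 3%N _ (395 / 1000) isT _ _ _ _ l3); lra.
have l5 : eventually_light 5 (27 / 100).
  by apply: eventually_light_weaken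
    (step 4%N _ (266 / 1000) isT _ _ _ _ l4); lra.
have l6 : eventually_light 6 (17 / 100).
  by apply: eventually_light_weaken
    (step 5%N _ (166 / 1000) isT _ _ _ _ l5); lra.
have l7 : eventually_light 7 (9 / 100).
  by apply: eventually_light_weaken
    (step 6%N _ (87 / 1000) isT _ _ _ _ l6); lra.
have l8 : eventually_light 8 (36 / 1000).
  by apply: eventually_light_weaken
    (step 7%N _ (33 / 1000) isT _ _ _ _ l7); lra.
by apply: eventually_light_weaken
    (step 8%N _ (8 / 1000) isT _ _ _ _ l8); lra.
Qed.

End Soft.

(** * The doubly exponential regime *)

Section Strong.
Variable R : realType.
Implicit Types (t : ltree) (S l : nat).

(** The doubly exponential scale.  Level 9 + l is under control from time
    [stage_start S l] on, with density at most [stage_density l].  The factor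
    3 (12 + l) in the density compensates the factor k = 10 + l in the recursion
    a -> 3 k a^2, since (10 + l) (13 + l) <= (12 + l)^2.  The factor 16^l in the
    starting time makes the expected value of E_k at that time grow
    geometrically in l; this keeps the failure probabilities summable. *)
Definition tower l : nat := (2 ^ (2 ^ l))%N.
Definition stage_start S l : nat := (S * 16 ^ l * tower l)%N.
Definition stage_density l : R := (3 * (12 + l) * tower l)%N%:R^-1.
Definition stage_rate l : R := (10 + l)%N%:R * stage_density l ^+ 2.

Lemma tower_gt0 l : (0 < tower l)%N.
Proof. by rewrite expn_gt0. Qed.

Lemma towerS l : tower l.+1 = (tower l * tower l)%N.
Proof. by rewrite /tower expnS mul2n -addnn expnD. Qed.

Lemma stage_start_gt0 S l : (0 < S)%N -> (0 < stage_start S l)%N.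
Proof. by move=> S_gt0; rewrite !muln_gt0 S_gt0 expn_gt0 tower_gt0. Qed.

Lemma stage_startS S l : stage_start S l.+1 = (16 * stage_start S l * tower l)%N.
Proof. by rewrite /stage_start towerS expnS; lia. Qed.

Lemma stage_density_gt0 l : 0 < stage_density l.
Proof. by rewrite invr_gt0 ltr0n !muln_gt0 /= tower_gt0. Qed.

Lemma stage_rate_gt0 l : 0 < stage_rate l.
Proof. by rewrite mulr_gt0 ?exprn_gt0 ?stage_density_gt0. Qed.

Lemma tower_neq0 l : (tower l)%:R != 0 :> R.
Proof. by rewrite pnatr_eq0 -lt0n tower_gt0. Qed.

Lemma stage_densityE l : stage_density l = (3 * (12 + l%:R) * (tower l)%:R)^-1.
Proof. by rewrite /stage_density !natrM natrD. Qed.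

(** The recursion a -> 3 k a^2 of the densities. *)
Lemma stage_rate_le l : 3 * stage_rate l <= stage_density l.+1.
Proof.
rewrite /stage_rate !stage_densityE towerS natrM natrD -(natr1 l).
have l_ge0 : 0 <= l%:R :> R by [].
have T_neq0 := tower_neq0 l; move: (tower l)%:R T_neq0 l%:R l_ge0 => T T_neq0 x x_ge0.
have [x12 x13] : 12 + x != 0 /\ 12 + (x + 1) != 0 by split; rewrite gt_eqF //; lra.
have -> : 3 * ((10 + x) * (3 * (12 + x) * T)^-1 ^+ 2) =
    (10 + x) * (13 + x) / (12 + x) ^+ 2 * (3 * (12 + (x + 1)) * (T * T))^-1.
  by field; rewrite ?T_neq0 ?x12 ?x13.
apply: ler_piMl.
  by rewrite invr_ge0 -expr2 mulr_ge0 ?sqr_ge0 //; lra.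
rewrite ler_pdivrMr ?exprn_gt0 //; [nra|lra].
Qed.

(** This is what absorbs the intercept of the line for level 10 + l at the time
    at which the next stage starts. *)
Lemma stage_density_le l : 6 * stage_density l <= 16 * (tower l)%:R * stage_density l.+1.
Proof.
rewrite !stage_densityE towerS natrM -(natr1 l).
have l_ge0 : 0 <= l%:R :> R by [].
have T_gt0 : 0 < (tower l)%:R :> R by rewrite ltr0n tower_gt0.
move: (tower l)%:R T_gt0 l%:R l_ge0 => T T_gt0 x x_ge0.
have [x12 x13] : 0 < 12 + x /\ 0 < 12 + (x + 1) by split; lra.
have -> : 6 * (3 * (12 + x) * T)^-1 = 2 / ((12 + x) * T).
  by field; rewrite !gt_eqF.
have -> : 16 * T * (3 * (12 + (x + 1)) * (T * T))^-1 =
    (16 / 3 * (12 + x) / (12 + (x + 1))) / ((12 + x) * T).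
  by field; rewrite !gt_eqF.
rewrite ler_pM2r ?invr_gt0 ?mulr_gt0 // ler_pdivlMr //; lra.
Qed.

Definition stage_bound S l : pred ltree :=
  level_bound (10 + l) (stage_start S l) (stage_density l) (stage_rate l) (stage_rate l).

(** All stages before l have gone well during the whole past. *)
Fixpoint on_track S l t : bool :=
  if l is j.+1 then on_track S j t && always (stage_bound S j) t
  else always (light 9 (stage_density 0) (stage_start S 0)) t.

Lemma on_track_cons S l e t : on_track S l (e :: t) -> on_track S l t.
Proof.
elim: l => [|l IHl]; first exact: always_cons.
by case/andP => /IHl gl /always_cons al; rewrite /= gl al.
Qed.

Lemma on_track_leq S l j t : (l <= j)%N -> on_track S j t -> on_track S l t.
Proof.
move/subnKC <-; elim: (j - l)%N => [|i IHi]; first by rewrite addn0.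
by rewrite addnS => /andP[/IHi].
Qed.

Lemma on_track_stage S l t : (0 < S)%N -> (stage_start S l <= size t)%N ->
  on_track S l.+1 t ->
  (heavy (10 + l) t)%:R <=
    4 * stage_rate l * (size t)%:R + 4 * stage_density l * (stage_start S l)%:R.
Proof.
move=> S_gt0 s_t /andP[_]; case: t s_t => [|e t] s_t.
  by have := stage_start_gt0 l S_gt0; rewrite ltnNge s_t.
by case/andP => /implyP/(_ s_t) le_h _; apply: le_trans le_h _; lra.
Qed.

(** Once the next stage has started, the line that bounds E_(10+l) is below the
    density required of that stage: the slope takes 4/3 and the intercept at
    most 2/3 of the 2 units available. *)
Lemma on_track_light S l t : (0 < S)%N -> recursive_tree t -> on_track S l t ->
  (stage_start S l <= size t)%N -> heavy_prob R (9 + l) t <= stage_density l.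
Proof.
move=> S_gt0 tree_t; case: l => [|l] good_t s_t.
  by apply: always_light good_t; rewrite stage_start_gt0.
have t_gt0 : (0 < size t)%N by apply: leq_trans s_t; rewrite stage_start_gt0.
have s_t' : (stage_start S l <= size t)%N.
  apply: leq_trans s_t; rewrite stage_startS mulnAC leq_pmull //.
  by rewrite muln_gt0 /= tower_gt0.
rewrite /heavy_prob ler_pdivrMr ?ltr0n ?muln_gt0 // natrM addnS.
apply: le_trans (on_track_stage S_gt0 s_t' good_t) _.
have r_le := ler_wpM2r (ler0n R (size t)) (stage_rate_le l).
have d_le := ler_wpM2r (ler0n R (stage_start S l)) (stage_density_le l).
have : (stage_start S l.+1)%:R <= (size t)%:R :> R by rewrite ler_nat.
move/(ler_wpM2l (ltW (stage_density_gt0 l.+1))); rewrite stage_startS [(16 * _ * _)%:R]natrM [(16 * _)%:R]natrM.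
lra.
Qed.

(** The bound of [prob_level] for stage l, with exponent c = 1 / (4 k). *)
Definition stage_error S l : R :=
  5 / ((4 * (10 + l))%N%:R^-1 * stage_rate l) ^+ 2 *
  expR (- (2 * (4 * (10 + l))%N%:R^-1 * stage_density l * (stage_start S l)%:R)).

Lemma prob_stage S l n : (0 < S)%N -> (0 < n)%N ->
  prob R n (fun t => on_track S l t && ~~ always (stage_bound S l) t) <=
  stage_error S l.
Proof.
move=> S_gt0 n_gt0.
have k_neq0 : (10 + l)%:R != 0 :> R by rewrite pnatr_eq0.
have ck : (4 * (10 + l))%N%:R^-1 * (10 + l)%:R = 4^-1 :> R.
  by rewrite [(4 * _)%:R]natrM; move: (_ + _)%N%:R k_neq0 => k k_neq0; field.
have rate1 : stage_rate l <= 1.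
  have := stage_rate_le l; have : stage_density l.+1 <= 1.
    by rewrite invf_le1 ?ltr0n ?ler1n !muln_gt0 /= tower_gt0.
  by have := stage_rate_gt0 l; lra.
apply: prob_level n_gt0 => //.
- exact: stage_start_gt0.
- exact: stage_density_gt0.
- exact: stage_rate_gt0.
- exact: stage_rate_gt0.
- by have := stage_rate_gt0 l; lra.
- rewrite -/(stage_rate l).
  have := mulr_ge0 (ler0n R (10 + l).-1) (sqr_ge0 (stage_rate l)); lra.
- rewrite ck; lra.
- rewrite ck; lra.
- by move=> e t; exact: on_track_cons.
- by move=> t tree_t good_t s_t; apply: on_track_light good_t s_t.
Qed.

(** With z = 2^l, the prefactor is at most of order exp (8 z): it is a power of
    [tower l] times a polynomial in l.  The exponent of the exponential is of
    order S 16^l / l^2, hence at least S z / 720, and it wins when S is large. *)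
Lemma stage_error_le S l : (0 < S)%N ->
  stage_error S l <=
  80 * 36 ^+ 4 * expR (- ((S%:R / 720 - 8) * 2 ^+ l)).
Proof.
move=> S_gt0; rewrite /stage_error /stage_rate stage_densityE [(4 * _)%:R]natrM [(10 + l)%:R]natrD /stage_start.
rewrite [(_ * tower l)%:R]natrM [(S * _)%:R]natrM [(16 ^ l)%:R]natrX; set z : R := 2 ^+ l.
have -> : 16 ^+ l = z ^+ 4 by rewrite /z -exprM mulnC exprM; congr (_ ^+ _); ring.
have T_gt0 : 0 < (tower l)%:R :> R by rewrite ltr0n tower_gt0.
have l_z : 1 + l%:R <= z.
  by rewrite /z -natrX addrC natr1 ler_nat ltn_expl.
have T_z : (tower l)%:R <= expR z.
  have -> : z = (2 ^ l)%:R * 1 by rewrite mulr1 natrX.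
  rewrite expRM_natl /tower natrX lerXn2r ?nnegrE ?expR_ge0 //.
  by apply: le_trans (expR_ge1Dx 1); lra.
have z_e : z <= expR z by apply: le_trans (expR_ge1Dx z); lra.
have l_ge0 : 0 <= l%:R :> R by [].
move: (tower l)%:R T_gt0 T_z l%:R l_ge0 l_z S%:R (ler0n R S) => T T_gt0 T_z x x_ge0 l_z s s_ge0.
have z_ge1 : 1 <= z by lra.
have -> : 5 / ((4 * (10 + x))^-1 * ((10 + x) * (3 * (12 + x) * T)^-1 ^+ 2)) ^+ 2
    = 80 * (3 * (12 + x) * T) ^+ 4.
  by field; rewrite !gt_eqF //; lra.
have -> : - (2 * (4 * (10 + x))^-1 * (3 * (12 + x) * T)^-1 * (s * z ^+ 4 * T)) =
    - (s * z ^+ 4 / (6 * (10 + x) * (12 + x))).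
  by field; rewrite !gt_eqF //; lra.
have -> : - ((s / 720 - 8) * z) = z * 8 - s * z / 720 by field.
rewrite expRD.
have e1 : (3 * (12 + x) * T) ^+ 4 <= 36 ^+ 4 * expR (z * 8).
  have -> : expR (z * 8) = (expR z * expR z) ^+ 4.
    by rewrite -expRD -expRM_natl; congr expR; ring.
  rewrite -exprMn lerXn2r ?nnegrE ?mulr_ge0 ?expR_ge0 ?(ltW T_gt0) //; try lra.
  rewrite mulrA; apply: ler_pM => //; rewrite ?mulr_ge0 ?(ltW T_gt0) //; lra.
have e2 : expR (- (s * z ^+ 4 / (6 * (10 + x) * (12 + x)))) <=
    expR (- (s * z / 720)).
  have h1 : 10 + x <= 10 * z by lra.
  have h2 : 12 + x <= 12 * z by lra.
  have h3 : (10 + x) * (12 + x) <= (10 * z) * (12 * z).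
    by apply: ler_pM => //; lra.
  have h4 : z * z <= z * z * z by rewrite ler_peMr // mulr_ge0; lra.
  rewrite ler_expR lerN2 ler_pdivlMr; last by rewrite !mulr_gt0 //; lra.
  have -> : s * z / 720 * (6 * (10 + x) * (12 + x)) =
    s * z * ((10 + x) * (12 + x) / 120) by field.
  have -> : s * z ^+ 4 = s * z * (z * z * z) by ring.
  by rewrite ler_wpM2l ?mulr_ge0 //; lra.
rewrite -[leLHS]mulrA -[leRHS]mulrA; apply: ler_wpM2l => //.
rewrite [leRHS]mulrA; apply: (ler_pM _ (expR_ge0 _) e1 e2).
by rewrite exprn_ge0 // !mulr_ge0 ?(ltW T_gt0) //; lra.
Qed.

(** The errors of the stages form a geometric series whose sum is of order 1/S. *)
Lemma prob_off_track eps : 0 < eps ->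
  exists2 S, (0 < S)%N & forall l n, (0 < n)%N ->
    prob R n (fun t => ~~ on_track S l t) <= eps.
Proof.
move=> eps_gt0; have eps2_gt0 : 0 < eps / 2 by rewrite divr_gt0.
have [s s_gt0 ev_s] := eventually_light9 eps2_gt0.
pose C : R := 80 * 36 ^+ 4.
have C_gt0 : 0 < C by rewrite mulr_gt0 ?exprn_gt0.
have [s1 s1_gt0 s1_ge] := exists_nat_ge (720 * (8 + C / (eps / 2))).
pose S := (s + s1)%N.
have S_gt0 : (0 < S)%N by rewrite addn_gt0 s_gt0.
pose y : R := S%:R / 720 - 8.
have y_ge : C / (eps / 2) <= y.
  have : s1%:R <= S%:R :> R by rewrite ler_nat leq_addl.
  rewrite /y; move: (C / _) s1_ge => q; lra.
have y_gt0 : 0 < y by apply: lt_le_trans y_ge; rewrite divr_gt0.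
exists S => // l n n_gt0.
suff : prob R n (fun t => ~~ on_track S l t) <=
    eps / 2 + \sum_(1 <= i < l.+1) C * expR (- (y * i%:R)).
  move=> /le_trans; apply; rewrite [leRHS]splitr lerD2l -mulr_sumr.
  apply: le_trans (ler_wpM2l (ltW C_gt0) (sum_expR_le l y_gt0)) _.
  by rewrite ler_pdivrMr // mulrC -ler_pdivrMr.
elim: l => [|l IHl].
  rewrite big_geq // addr0; apply: le_trans (ev_s n n_gt0).
  apply: prob_le => // t tree_t _; apply: contra => light_t /=.
  have -> : stage_density 0 = 1 / 72 by rewrite mul1r.
  apply: always_light_leq light_t => //.
  by rewrite /stage_start /tower /S; lia.
rewrite big_nat_recr //= addrA.
apply: (@le_trans _ _ (prob R n (fun t => ~~ on_track S l t) +
    prob R n (fun t => on_track S l t && ~~ always (stage_bound S l) t))).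
  by apply: prob_leU => // t _ _ /=; rewrite negb_and; case: (on_track S l t).
apply: lerD => //.
apply: le_trans (prob_stage l S_gt0 n_gt0) _.
apply: le_trans (stage_error_le l S_gt0) _; rewrite -/C -/y ler_pM2l //.
rewrite ler_expR lerN2 ler_pM2l // -natrX ler_nat; exact: ltn_expl.
Qed.

End Strong.

(** * The upper bound on the maximum degree *)

(** The youngest vertex was attached to a vertex of degree at least D. *)
Definition high_parent (D : nat) (t : ltree) : bool :=
  (D <= degree (behead t) (last_parent t))%N.

(** A degree can exceed D only by the attachment of a vertex to a vertex of
    degree D. *)
Lemma max_degree_no_high_parent D t : (0 < D)%N -> recursive_tree t ->
  always (predC (high_parent D)) t -> (max_degree t <= D)%N.
Proof.
move=> D_gt0 tree_t no_jump; apply/bigmax_leqP_seq => v _ _; move: v.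
elim: t tree_t no_jump => [//|[x y] t IHt] /and3P[/= x_t /eqP -> tree_t].
move=> /andP[nojump_x /(IHt tree_t) deg_t] v.
rewrite -/(attach t x) degree_attach //; case: ifP => // _.
have [->|_] := eqVneq v x; last by rewrite addn0.
by move: nojump_x; rewrite /high_parent /last_parent /= -ltnNge addn1.
Qed.

Lemma heavy_small D t : (size t < D)%N -> heavy D t = 0%N.
Proof.
move=> t_D; rewrite /heavy big_pred0 // => v; apply/negbTE.
by rewrite -ltnNge (leq_ltn_trans _ t_D) // count_size.
Qed.

Section Upper.
Variable R : realType.
Implicit Types (t : ltree) (S D : nat).

Lemma stage_index S n : (0 < S)%N -> (stage_start S 0 <= n)%N ->
  exists2 l, (stage_start S l <= n)%N & (n < stage_start S l.+1)%N.
Proof.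
move=> S_gt0 n_ge.
have bounded l : (stage_start S l <= n)%N -> (l <= n)%N.
  apply: leq_trans; apply: leq_trans (ltnW (ltn_expl l (isT : 1 < 16)%N)) _.
  by rewrite /stage_start mulnAC leq_pmull // muln_gt0 S_gt0 tower_gt0.
have := ex_maxnP (ex_intro (fun l => stage_start S l <= n)%N 0%N n_ge) bounded.
case=> l n_l max_l; exists l => //; rewrite ltnNge; apply/negP => /max_l.
by rewrite ltnn.
Qed.

(** At a time n between the starts of stages l and l + 1, the density at level
    10 + l is at most S 16^l / n, since n is less than 16 S 16^l times the square
    of [tower l].  As [tower l] <= n, the factor 256^l in the square is
    negligible: it is at most 2^56 sqrt n, the constant being what makes
    16 l <= 112 + 2^l true for all l. *)
Lemma sqr_heavy_prob_le S D t : (0 < S)%N -> recursive_tree t ->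
  on_track R S D t -> (9 < D)%N -> (stage_start S 0 <= size t)%N ->
  (size t < tower (D - 9))%N ->
  heavy_prob R D t ^+ 2 <=
    S%:R ^+ 2 * 2 ^+ 56 * ((size t)%:R * Num.sqrt (size t)%:R)^-1.
Proof.
move=> S_gt0 tree_t good_t D_gt9 start_t t_lt.
have [l l_t t_l] := stage_index S_gt0 start_t.
have tower_t : (tower l <= size t)%N.
  by apply: leq_trans l_t; rewrite /stage_start leq_pmull // muln_gt0 S_gt0 expn_gt0.
have l_D : (l < D - 9)%N.
  by have := leq_ltn_trans tower_t t_lt; rewrite /tower !ltn_exp2l.
have := on_track_stage S_gt0 l_t (on_track_leq _ good_t); move=> /(_ ltac:(lia)).
have t_gt0 : (0 : R) < (size t)%:R.
  by rewrite ltr0n; apply: leq_trans tower_t; apply: tower_gt0.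
set u : R := (size t)%:R in t_gt0 *.
set q : R := S%:R * 16 ^+ l.
have q_ge0 : 0 <= q by rewrite mulr_ge0 ?exprn_ge0.
move=> heavy_t.
have p_le : heavy_prob R D t <= q / u.
  have h_le : (heavy D t)%:R <= (heavy (10 + l) t)%:R :> R.
    by rewrite ler_nat leq_heavy //; lia.
  have d_le : stage_density R l * (stage_start S l)%:R <= q / 36.
    rewrite stage_densityE /stage_start [(_ * tower l)%:R]natrM [(S * _)%:R]natrM natrX -/q.
    have l_ge0 : 0 <= l%:R :> R by [].
    have T_neq0 := tower_neq0 R l.
    move: (tower l)%:R T_neq0 l%:R l_ge0 => T T_neq0 x x_ge0.
    have x12 : 12 + x != 0 by rewrite gt_eqF //; lra.
    have -> : (3 * (12 + x) * T)^-1 * (q * T) = q * (3 * (12 + x))^-1.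
      by field; rewrite T_neq0 x12.
    by rewrite ler_wpM2l // lef_pV2 ?posrE; lra.
  have r_le : 3 * stage_rate R l * u <= q / 2.
    apply: le_trans (ler_wpM2r (ltW t_gt0) (stage_rate_le R l)) _.
    have u_le : u <= 16 * q * ((tower l)%:R * (tower l)%:R).
      have : u <= (stage_start S l.+1)%:R by rewrite ler_nat ltnW.
      rewrite stage_startS /stage_start [(_ * _ * tower l)%:R]natrM [(16 * _)%:R]natrM.
      rewrite [(_ * tower l)%:R]natrM [(S * _)%:R]natrM natrX -/q; lra.
    apply: le_trans (ler_wpM2l (ltW (stage_density_gt0 R l.+1)) u_le) _.
    rewrite stage_densityE towerS [(tower l * _)%:R]natrM -(natr1 l).
    have l_ge0 : 0 <= l%:R :> R by [].
    have T_neq0 := tower_neq0 R l.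
    move: (tower l)%:R T_neq0 l%:R l_ge0 => T T_neq0 x x_ge0.
    have x12 : 12 + (x + 1) != 0 by rewrite gt_eqF //; lra.
    have -> : (3 * (12 + (x + 1)) * (T * T))^-1 * (16 * q * (T * T)) =
        q * (16 / (3 * (12 + (x + 1)))).
      by field; rewrite T_neq0 x12.
    by rewrite ler_wpM2l // ler_pdivrMr; lra.
  rewrite /heavy_prob natrM ler_pdivrMr ?mulr_gt0 // -/u.
  have -> : q / u * (2 * u) = 2 * q by field; rewrite gt_eqF.
  by move: heavy_t; lra.
have p_ge0 := heavy_prob_ge0 R D t.
apply: (@le_trans _ _ ((q / u) ^+ 2)); first by rewrite ler_sqr ?nnegrE // (le_trans p_ge0).
have s_gt0 : 0 < Num.sqrt u by rewrite sqrtr_gt0.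
have pow_le : 256 ^+ l <= 2 ^+ 56 * Num.sqrt u.
  have -> : 2 ^+ 56 * Num.sqrt u = Num.sqrt (2 ^+ 112 * u).
    rewrite sqrtrM ?exprn_ge0 // (_ : 112 = 56 * 2)%N // exprM sqrtr_sqr.
    by rewrite ger0_norm ?exprn_ge0.
  have -> : 256 ^+ l = Num.sqrt ((256 ^+ l) ^+ 2) :> R.
    by rewrite sqrtr_sqr ger0_norm ?exprn_ge0.
  apply: ler_wsqrtr.
  apply: (@le_trans _ _ (2 ^+ 112 * (tower l)%:R)); last first.
    by rewrite ler_wpM2l ?exprn_ge0 // ler_nat.
  rewrite /tower natrX -exprD -exprM (_ : 256 = 2 ^+ 8 :> R); last by ring.
  rewrite -exprM ler_weXn2l ?ler1n //.
  elim: (l) => // i IHi; rewrite expnS; have := ltn_expl i (isT : (1 < 2)%N).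
  case: (ltnP i 4) => i4; first by lia.
  have := leq_pexp2l (isT : (0 < 2)%N) i4; move: IHi.
  by rewrite (_ : 2 ^ 4 = 16)%N //; lia.
have -> : (q / u) ^+ 2 = S%:R ^+ 2 * (256 ^+ l) / (u * u).
  rewrite (_ : 256 = 16 ^+ 2 :> R); last by ring.
  by rewrite /q -exprM mulnC exprM; field; rewrite gt_eqF.
have -> : (u * Num.sqrt u)^-1 = Num.sqrt u / (u * u).
  have := sqr_sqrtr (ltW t_gt0); move: (Num.sqrt u) s_gt0 => r r_gt0 <-.
  by field; rewrite gt_eqF.
rewrite mulrA ler_pM2r ?invr_gt0 ?mulr_gt0 // -mulrA ler_wpM2l ?sqr_ge0 //.
Qed.

(** A telescoping comparison with the increments of 2 / sqrt u. *)
Lemma sum_inv_sqrt_le n m : (0 < n)%N ->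
  \sum_(n <= u < m) (u.+1%:R * Num.sqrt u.+1%:R)^-1 <= 2 / Num.sqrt n%:R :> R.
Proof.
move=> n_gt0; have [m_n|n_m] := leqP m n.
  by rewrite big_geq // divr_ge0 // sqrtr_ge0.
have telescope u : (0 < u)%N -> (u.+1%:R * Num.sqrt u.+1%:R)^-1 <=
    2 / Num.sqrt u%:R - 2 / Num.sqrt u.+1%:R :> R.
  move=> u_gt0; have := sqr_sqrtr (ler0n R u.+1); have := sqr_sqrtr (ler0n R u).
  have : 0 < Num.sqrt u%:R :> R by rewrite sqrtr_gt0 ltr0n.
  have : 0 < Num.sqrt u.+1%:R :> R by rewrite sqrtr_gt0 ltr0n.
  move: (Num.sqrt u.+1%:R) (Num.sqrt u%:R) => q p q_gt0 p_gt0 p2 q2.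
  have q2E : q ^+ 2 = p ^+ 2 + 1 by rewrite q2 p2 natr1.
  rewrite -q2.
  have -> : 2 / p - 2 / q = 2 * q ^+ 2 * (q - p) / p * (q ^+ 2 * q)^-1.
    by field; rewrite !gt_eqF.
  rewrite ler_peMl ?invr_ge0 ?mulr_ge0 ?(ltW q_gt0) // ler_pdivlMr // mul1r.
  have pq : p <= q by rewrite -(ler_sqr (x := p)) ?nnegrE ?(ltW p_gt0) ?(ltW q_gt0) // q2E lerDl.
  have diff : (q - p) * (q + p) = 1 by rewrite -subr_sqr q2E addrAC subrr add0r.
  have : (q - p) * (q + p) <= (q - p) * (2 * q) by rewrite ler_wpM2l; lra.
  rewrite diff => le1; have := ler_wpM2r (ltW q_gt0) le1; rewrite mul1r expr2; lra.
apply: (@le_trans _ _ (2 / Num.sqrt n%:R - 2 / Num.sqrt m%:R)); last first.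
  by rewrite gerBl divr_ge0 // sqrtr_ge0.
have -> : 2 / Num.sqrt n%:R - 2 / Num.sqrt m%:R =
    - (2 / Num.sqrt m%:R) - - (2 / Num.sqrt n%:R) :> R by rewrite opprK addrC.
rewrite -(telescope_sumr (fun u => - (2 / Num.sqrt u%:R) : R)) ?(ltnW n_m) //.
rewrite !big_nat; apply: ler_sum => u /andP[n_u _].
by rewrite opprK addrC telescope // (leq_trans n_gt0).
Qed.

(** Before time D there is no vertex of degree D at all; this covers the times
    before the first stage. *)
Lemma prob_high_parent S D n : (0 < S)%N -> (9 < D)%N -> (stage_start S 0 <= D)%N ->
  (0 < n < tower (D - 9))%N ->
  prob R n.+1 (fun t => on_track R S D t && high_parent D t) <=
  if (n < D)%N then 0
  else S%:R ^+ 2 * 2 ^+ 56 * (n%:R * Num.sqrt n%:R)^-1.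
Proof.
move=> S_gt0 D_gt9 start_D /andP[n_gt0 n_lt]; rewrite /prob meanS //.
rewrite -[leRHS](@mean_cst R n) //; apply: mean_le => // t tree_t st.
apply: (@le_trans _ _ ((on_track R S D t)%:R * heavy_prob R D t ^+ 2)).
  rewrite -mean_step_heavy -mean_stepZ; apply: mean_step_le => // v v_t.
  rewrite /high_parent /last_parent /= -natrM ler_nat.
  have := @on_track_cons R S D (v, (size t).+2) t; rewrite /attach.
  by case: (on_track _ _ _ (_ :: _)) => [/(_ isT) ->|//]; rewrite mul1n.
case: ifP => [n_D|/negbT]; first by rewrite /heavy_prob heavy_small ?st // mul0r expr0n mulr0.
rewrite -leqNgt => D_n; have [good_t|_] := boolP (on_track _ _ _ _).
  rewrite mul1r -st; apply: sqr_heavy_prob_le => //; rewrite st //.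
  exact: leq_trans start_D D_n.
by rewrite mul0r !mulr_ge0 ?invr_ge0 ?mulr_ge0 ?sqrtr_ge0 ?exprn_ge0.
Qed.

(** D = log_2 log_2 m + 9 suffices: a stage l that has started before time m
    satisfies [tower l] < m, so that its level 10 + l is at most D.  The constant
    S is fixed first, to make the probability of being off track small; then D
    large makes the tail of the series of n^(-3/2) small. *)
Theorem prob_max_degree_large (eps : R) : 0 < eps ->
  exists D0, forall D m, (D0 <= D)%N -> (0 < m <= tower (D - 9))%N ->
    prob R m (fun t => (D < max_degree t)%N) <= eps.
Proof.
move=> eps_gt0; have eps2_gt0 : 0 < eps / 2 by rewrite divr_gt0.
have [S S_gt0 good_S] := prob_off_track eps2_gt0.
pose C : R := S%:R ^+ 2 * 2 ^+ 56.
have C_gt0 : 0 < C by rewrite mulr_gt0 ?exprn_gt0 // ltr0n.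
have [N N_gt0 N_ge] := exists_nat_ge ((2 * C / (eps / 2)) ^+ 2).
exists (stage_start S 0 + N + 10)%N => D m D_ge /andP[m_gt0 m_le].
apply: (@le_trans _ _ (prob R m (fun t => ~~ on_track R S D t) +
    prob R m (fun t => on_track R S D t && ~~ always (predC (high_parent D)) t))).
  apply: prob_leU => // t tree_t _; rewrite ltnNge => large.
  case: (on_track _ _ _ _) => //=; apply: contra large.
  by apply: max_degree_no_high_parent => //; lia.
rewrite [leRHS]splitr; apply: lerD; first exact: good_S.
apply: le_trans (prob_not_always _ _ _ _) _ => //.
  by move=> e t; exact: on_track_cons.
rewrite big_nat_recl //= [X in X + _](_ : _ = 0) ?add0r; last first.
  rewrite -(@mean_cst R 1 0) //; apply: eq_mean => // -[//|e [|//]] _ _.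
  by rewrite negbK /high_parent /= leqNgt (_ : (_ < D)%N) ?andbF //; rewrite /degree /=; lia.
apply: (@le_trans _ _ (\sum_(1 <= i < m) if (D <= i)%N
    then C * (i%:R * Num.sqrt i%:R)^-1 else 0)).
  rewrite !big_nat; apply: ler_sum => i /andP[i_gt0 i_m].
  apply: le_trans (_ : prob R i.+1 (fun t => on_track R S D t && high_parent D t) <= _).
    by apply: prob_le => // t _ _; rewrite /= negbK.
  apply: le_trans (prob_high_parent (n := i) S_gt0 _ _ _) _.
  - by lia.
  - by lia.
  - by rewrite i_gt0 (leq_trans i_m).
  - by rewrite ltnNge; case: (D <= i)%N.
rewrite -big_mkcond /= -(big_nat_widenl D 1 m xpredT); last by lia.
rewrite -mulr_sumr.
have D_gt0 : (0 < D)%N by lia.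
rewrite -(prednK D_gt0) big_add1.
apply: le_trans (ler_wpM2l (ltW C_gt0) (sum_inv_sqrt_le _ _)) _; first by lia.
have N_le : Num.sqrt N%:R <= Num.sqrt D.-1%:R :> R.
  by apply: ler_wsqrtr; rewrite ler_nat; lia.
have K_ge0 : 0 <= 2 * C / (eps / 2) by rewrite divr_ge0 ?mulr_ge0 ?(ltW C_gt0) // ltW.
have : 2 * C / (eps / 2) <= Num.sqrt D.-1%:R.
  apply: le_trans N_le; rewrite -[leLHS]ger0_norm // -sqrtr_sqr.
  exact: ler_wsqrtr.
have D_sqrt : 0 < Num.sqrt D.-1%:R :> R by rewrite sqrtr_gt0 ltr0n; lia.
rewrite ler_pdivrMr // => le_C; rewrite mulrA ler_pdivrMr //; lra.
Qed.

End Upper.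

(** * The lower bound on the maximum degree *)

Section Lower.
Variable R : realType.
Implicit Types (t : ltree) (f : ltree -> R).

Lemma leq_heavy_attach k t v :
  recursive_tree t -> (0 < v <= (size t).+1)%N -> (0 < k)%N ->
  (heavy k t <= heavy k (attach t v))%N.
Proof.
move=> tree_t v_t; case: k => [//|[_|k _]]; last by rewrite heavy_attach // leq_addr.
by rewrite !heavy1 ?recursive_tree_attach //= leq_mul2l leqnSn.
Qed.

Lemma iter_mean_step_cst n (x : R) t : recursive_tree t -> (0 < size t)%N ->
  iter n (@mean_step R) (fun=> x) t = x.
Proof.
move=> tree_t t_gt0; elim: n t tree_t t_gt0 => [//|n IHn] t tree_t t_gt0 /=.
rewrite -[RHS](@mean_step_cst _ _ t) //.
apply/eqP; rewrite eq_le; apply/andP; split; apply: mean_step_le => // v v_t;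
  by rewrite IHn ?recursive_tree_attach.
Qed.

(** E_(k+1) increases by at least 1 when the parent has degree at least k, which
    has probability p_k^2, and 1/e <= 1/2. *)
Lemma mean_step_expRN_heavy k t : (0 < k)%N ->
  recursive_tree t -> (0 < size t)%N ->
  mean_step (fun u => expR (- (heavy k.+1 u)%:R)) t <=
  expR (- (heavy_prob R k t ^+ 2 / 2)) * expR (- (heavy k.+1 t)%:R).
Proof.
move=> k_gt0 tree_t t_gt0; set h := expR (- (heavy _ _)%:R).
apply: (@le_trans _ _ (mean_step (fun u : ltree =>
   h * (1 + (- 2^-1) * (k <= degree t (last_parent u))%N%:R)) t)).
  apply: mean_step_le => // v v_t.
  rewrite heavy_attach // natrD opprD expRD ler_pM2l ?expR_gt0 //=.
  have expRN_le i : (0 < i)%N -> expR (- i%:R) <= 1 + (- 2^-1) * 1 :> R.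
    move=> i_gt0; apply: (@le_trans _ _ (expR (- 1))).
      by rewrite ler_expR lerN2 ler1n.
    by apply: le_trans (expRN_le_linear _) _; lra.
  rewrite /last_parent /=.
  case: ifP => [k_v|_]; first by rewrite (ltnW k_v) expRN_le.
  by case: ifP => _; rewrite ?expRN_le // oppr0 expR0 mulr0 addr0.
rewrite mean_stepZ mean_stepD mean_stepZ mean_step_cst // mean_step_heavy mulrC.
by rewrite ler_pM2r ?expR_gt0 // mulNr [_^-1 * _]mulrC expR_ge1Dx.
Qed.

Lemma iter_mean_step_expRN_heavy k m (g : R) n t : (0 < k)%N -> 0 <= g ->
  recursive_tree t -> (0 < size t)%N -> (size t + n <= m)%N ->
  g <= (heavy k t)%:R ->
  iter n (@mean_step R) (fun u => expR (- (heavy k.+1 u)%:R)) t <=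
  expR (- ((g / (2 * m)%:R) ^+ 2 / 2 * n%:R)) * expR (- (heavy k.+1 t)%:R).
Proof.
move=> k_gt0 g_ge0; set q := _ ^+ 2 / 2.
elim: n t => [|n IHn] t tree_t t_gt0 le_m g_le /=.
  by rewrite mulr0 oppr0 expR0 mul1r.
apply: (@le_trans _ _ (mean_step (fun u => expR (- (q * n%:R)) *
    expR (- (heavy k.+1 u)%:R)) t)).
  apply: mean_step_le => // v v_t; apply: IHn => //.
  - exact: recursive_tree_attach.
  - by rewrite /= addSnnS.
  - by apply: le_trans g_le _; rewrite ler_nat leq_heavy_attach.
rewrite mean_stepZ -(natr1 n) mulrDr mulr1 opprD expRD -mulrA ler_pM2l ?expR_gt0 //.
apply: le_trans (mean_step_expRN_heavy _ _ _) _ => //.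
rewrite ler_pM2r ?expR_gt0 // ler_expR lerN2 /q ler_pM2r //.
have n_gt0 : (0 : R) < (2 * size t)%:R by rewrite ltr0n; lia.
have m_gt0 : (0 : R) < (2 * m)%:R by rewrite ltr0n; lia.
rewrite ler_sqr ?nnegrE ?divr_ge0 ?(ltW m_gt0) // /heavy_prob.
apply: ler_pM => //.
by rewrite lef_pV2 ?posrE // ler_nat; lia.
Qed.

(** If E_k >= g at time n, then in each of the next j steps, up to time m, the
    probability that E_(k+1) increases is at least (g / 2m)^2.  A Chernoff bound
    then compares E_(k+1) with h. *)
Lemma prob_heavy_step k m n j (g h : R) : (0 < k)%N -> (0 < n)%N ->
  (n + j <= m)%N -> 0 <= g ->
  prob R (n + j) (fun t => (heavy k.+1 t)%:R < h) <=
  prob R n (fun t => (heavy k t)%:R < g) +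
  expR (h - (g / (2 * m)%:R) ^+ 2 / 2 * j%:R).
Proof.
move=> k_gt0 n_gt0 le_m g_ge0; set q := _ ^+ 2 / 2.
pose f t : R := ((heavy k.+1 t)%:R < h)%R%:R.
have -> : prob R (n + j) (fun t => (heavy k.+1 t)%:R < h) =
    mean n (iter j (@mean_step R) f).
  rewrite /prob /mean -/f -iterD; congr (iter _ _ _ _); lia.
rewrite -[X in _ + X](@mean_cst R n) // -meanD; apply: mean_le => // t tree_t st.
have [lt_g|le_g] := ltP (_ : R) g.
  apply: (@le_trans _ _ 1); last by rewrite lerDl expR_ge0.
  rewrite -[leRHS](@iter_mean_step_cst j _ t) ?st //.
  apply: iter_mean_step_le => // u _ _; rewrite /f; by case: (_ < _).
rewrite add0r expRD.
apply: (@le_trans _ _ (iter j (@mean_step R)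
   (fun u => expR h * expR (- (heavy k.+1 u)%:R)) t)).
  apply: iter_mean_step_le => // u _ _; rewrite /f; case: ltP => [lt_h|_].
    rewrite -expRD -[leLHS]expR0 ler_expR subr_ge0 ltW //.
  by rewrite mulr_ge0 ?expR_ge0.
have -> : iter j (@mean_step R) (fun u => expR h * expR (- (heavy k.+1 u)%:R)) t
  = expR h * iter j (@mean_step R) (fun u => expR (- (heavy k.+1 u)%:R)) t.
  elim: j {le_m q} t {tree_t st le_g} => [//|j IHj] t /=.
  rewrite -mean_stepZ; apply: eq_bigr => x _; apply: eq_bigr => y _.
  by apply: eq_bigr => b _; rewrite IHj.
rewrite ler_pM2l ?expR_gt0 //.
apply: le_trans (iter_mean_step_expRN_heavy k_gt0 g_ge0 tree_t _ _ le_g) _.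
- by rewrite st.
- by rewrite st; exact: le_m.
rewrite -/q ler_piMr ?expR_ge0 // -[leRHS]expR0 ler_expR oppr_le0 //.
Qed.

(** Level k is reached during the k-th of successive blocks of m/2, m/4, m/8, ...
    steps.  The blocks must shrink geometrically: with equal blocks, the number
    of levels would enter the recursion, and the bound would lose an unbounded
    number of levels. *)
Definition checkpoint m k : nat := (\sum_(1 <= i < k.+1) m %/ 2 ^ i)%N.

Lemma checkpoint_le m k : (checkpoint m k <= m)%N.
Proof.
have : (checkpoint m k + m %/ 2 ^ k <= m)%N; last by move: (m %/ 2 ^ k)%N => q; lia.
elim: k => [|k IHk]; first by rewrite /checkpoint big_geq // expn0 divn1.
rewrite /checkpoint big_nat_recr //= -/(checkpoint m k).
have : (m %/ 2 ^ k.+1 + m %/ 2 ^ k.+1 <= m %/ 2 ^ k)%N.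
  by rewrite expnSr divnMA; move: (m %/ 2 ^ k)%N => q; lia.
by move: IHk; move: (m %/ _)%N (m %/ _)%N => p q; lia.
Qed.

Lemma le_half_pow_div m k : (2 ^ k <= m)%N ->
  (m%:R / 2 ^+ k.+1 : R) <= (m %/ 2 ^ k)%:R.
Proof.
move=> le_m; rewrite ler_pdivrMr ?exprn_gt0 // -natrX -natrM ler_nat.
have q_gt0 : (0 < m %/ 2 ^ k)%N by rewrite divn_gt0 ?expn_gt0.
have r_lt : (m %% 2 ^ k < 2 ^ k)%N by rewrite ltn_pmod ?expn_gt0.
have := divn_eq m (2 ^ k); rewrite expnS.
move: (m %/ 2 ^ k)%N (m %% 2 ^ k)%N (2 ^ k)%N q_gt0 r_lt => q r x *; nia.
Qed.

(** The solution, with initial value 1/2, of the recursion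
    g_(k+1) = g_k^2 / 2^(k+6). *)
Definition floor_density k : R := 2 ^+ (k + 7) / 2 ^+ (9 * 2 ^ k.-1).

(** Up to level r, the lower bound for E_k stays above 2^(9 2^(r-1)), by the
    assumption on m; each level fails with a probability that is at most the
    inverse of that number. *)
Lemma prob_heavy_checkpoint m r k : (2 ^ (9 * 2 ^ r) <= m)%N -> (0 < k <= r)%N ->
  prob R (checkpoint m k) (fun t => (heavy k t)%:R < floor_density k * m%:R) <=
  k%:R / 2 ^+ (9 * 2 ^ r.-1).
Proof.
move=> le_m; have pow_le i : (0 < i <= r.+1)%N -> (2 ^ i <= m)%N.
  move=> i_r; apply: leq_trans le_m; rewrite leq_exp2l //.
  have := ltn_expl r (isT : (1 < 2)%N); lia.
have gamma_gt0 i : 0 < floor_density i by rewrite divr_gt0 ?exprn_gt0.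
case: k => [//|k]; elim: k => [|k IHk] k_r.
  have m_ge := pow_le 1%N isT; rewrite expn1 in m_ge.
  rewrite /checkpoint big_nat1 expn1 [leLHS](_ : _ = 0) ?divr_ge0 ?exprn_ge0 //.
  have half_gt0 : (0 < m %/ 2)%N by lia.
  rewrite -(@mean_cst R (m %/ 2) 0) //; apply: eq_mean => // t tree_t st.
  rewrite heavy1 // st [(_ < _)](_ : _ = false) //; apply/negbTE; rewrite -leNgt.
  have -> : floor_density 1 = 2^-1 by rewrite /floor_density /= expn0 muln1; field.
  rewrite mulrC ler_pdivrMr // -natrM ler_nat; lia.
rewrite /checkpoint big_nat_recr //= -/(checkpoint m k.+1).
set n := checkpoint m k.+1; set j := (m %/ _)%N.
have n_gt0 : (0 < n)%N.
  rewrite /n /checkpoint big_nat_recl // expn1.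
  have := pow_le 1%N isT; rewrite expn1; lia.
have nj_le : (n + j <= m)%N.
  by have := checkpoint_le m k.+2; rewrite /checkpoint big_nat_recr.
apply: le_trans (@prob_heavy_step k.+1 m n j (floor_density k.+1 * m%:R) _
   _ n_gt0 nj_le _) _ => //.
  by rewrite mulr_ge0 // ltW.
rewrite -[in leRHS]natr1 mulrDl; apply: lerD; first by apply: IHk; lia.
have m_gt0 : (0 : R) < m%:R by rewrite ltr0n; have := pow_le 1%N isT; lia.
set h := floor_density k.+2 * m%:R.
have j_ge : m%:R / 2 ^+ k.+3 <= j%:R :> R.
  by apply: le_half_pow_div; apply: pow_le; lia.
(* In the (k+2)-nd block, of at least m / 2^(k+3) steps, the expected logarithmic
   decay of exp (- E) is at least twice the value h to be reached. *)
have drop : 2 * h <= (floor_density k.+1 * m%:R / (2 * m)%:R) ^+ 2 / 2 * j%:R.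
  rewrite [(2 * m)%:R]natrM -mulf_div divff ?gt_eqF // mulr1.
  apply: le_trans (ler_wpM2l _ j_ge); last by rewrite divr_ge0 ?sqr_ge0.
  rewrite /h [leLHS]mulrA [leRHS]mulrA [leRHS]mulrAC ler_pM2r //.
  rewrite /floor_density /= !expr_div_n -!exprM [(2 ^ k.+1)%N]expnS.
  rewrite [(9 * (2 * 2 ^ k))%N](_ : _ = (9 * 2 ^ k) * 2)%N; last lia.
  have : (2 : R) ^+ (9 * 2 ^ k * 2) != 0 by rewrite expf_neq0.
  move: (2 ^+ (9 * 2 ^ k * 2)) => X X_neq0.
  rewrite (_ : ((k.+1 + 7) * 2 = k + k + 16)%N); last lia.
  rewrite [2 ^+ (k.+2 + 7)]exprD [2 ^+ (k + k + 16)]exprD [2 ^+ (k + k)]exprD.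
  rewrite !(exprS _ k.+2) !(exprS _ k.+1) !(exprS _ k).
  have : (2 : R) ^+ k != 0 by rewrite expf_neq0.
  move: (2 ^+ k) => Y Y_neq0.
  rewrite le_eqVlt; apply/orP; left; apply/eqP; field.
  by rewrite X_neq0 Y_neq0.
have h_ge : 2 ^+ (9 * 2 ^ r.-1) <= h.
  rewrite /h /floor_density mulrAC ler_pdivlMr ?exprn_gt0 // -exprD.
  apply: (@le_trans _ _ m%:R).
    rewrite -natrX ler_nat; apply: leq_trans le_m; rewrite leq_exp2l // -mulnDr.
    rewrite leq_mul2l /=.
    have -> : (2 ^ r = 2 ^ r.-1 + 2 ^ r.-1)%N.
      by rewrite addnn -mul2n -expnS prednK //; lia.
    by rewrite leq_add2l leq_exp2l //; lia.
  by rewrite ler_peMl // exprn_ege1 // ler1n.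
apply: (@le_trans _ _ (expR (- h))); first by rewrite ler_expR; lra.
have P_gt0 : (0 : R) < 2 ^+ (9 * 2 ^ r.-1) by rewrite exprn_gt0.
rewrite expRN mul1r lef_pV2 ?posrE ?expR_gt0 //.
apply: le_trans (expR_ge1Dx _); apply: le_trans h_ge _; lra.
Qed.

Lemma prob_decreasing (A : pred ltree) n m : (0 < n <= m)%N ->
  (forall t e, recursive_tree (e :: t) -> A (e :: t) -> A t) ->
  prob R m A <= prob R n A.
Proof.
move=> nm A_dec; rewrite -(subnKC (proj2 (andP nm))).
elim: (m - n)%N => [|i IHi]; first by rewrite addn0.
apply: le_trans IHi; rewrite addnS -[leRHS]prob_behead; last lia.
by apply: prob_le => // -[//|e t] tree_t _ /=; exact: A_dec.
Qed.

Lemma max_degree_ge t v : recursive_tree t -> (degree t v <= max_degree t)%N.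
Proof.
move=> tree_t; have [v_t|out] := boolP (0 < v <= (size t).+1)%N; last first.
  by rewrite degree_outside.
rewrite /max_degree (bigD1_seq v) ?iota_uniq ?mem_index_iota //=.
  exact: leq_maxl.
Qed.

Theorem prob_max_degree_small m r : (0 < r)%N -> (2 ^ (9 * 2 ^ r) <= m)%N ->
  prob R m (fun t => (max_degree t < r)%N) <= r%:R^-1.
Proof.
move=> r_gt0 le_m.
have m_gt1 : (1 < m)%N.
  by apply: leq_trans le_m; rewrite -{1}(expn1 2) leq_exp2l // muln_gt0 expn_gt0.
have gamma_gt0 : 0 < floor_density r by rewrite divr_gt0 ?exprn_gt0.
apply: (@le_trans _ _ (prob R m (fun t => (heavy r t)%:R < floor_density r * m%:R))).
  apply: prob_le => [|t tree_t _ lt_r]; first lia.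
  have -> : heavy r t = 0%N.
    rewrite /heavy big_pred0 // => v; apply/negbTE; rewrite -ltnNge.
    by apply: leq_ltn_trans lt_r; apply: max_degree_ge.
  by rewrite mulr_gt0 // ltr0n; lia.
apply: (@le_trans _ _ (r%:R / 2 ^+ (9 * 2 ^ r.-1))).
  apply: le_trans (prob_heavy_checkpoint le_m _); last by rewrite r_gt0 leqnn.
  apply: prob_decreasing => [|t [v w] /and3P[/= v_t /eqP -> tree_t]].
    rewrite checkpoint_le andbT /checkpoint big_nat_recl // expn1; lia.
  by apply: le_lt_trans; rewrite ler_nat leq_heavy_attach.
have r_le : (r <= 2 ^ r.-1)%N by have := ltn_expl r.-1 (isT : (1 < 2)%N); lia.
rewrite ler_pdivrMr ?exprn_gt0 // -(@ler_pM2l _ r%:R) ?ltr0n //.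
rewrite mulrA divff ?pnatr_eq0 -?lt0n // mul1r -natrX -natrM ler_nat.
apply: leq_trans (leq_mul r_le r_le) _; rewrite -expnD leq_exp2l //; lia.
Qed.

End Lower.

(** * Transfer to the probability space, and the double logarithm *)

Lemma uniq_pairs (S T : eqType) (s : seq S) (t : seq T) :
  uniq s -> uniq t -> uniq [seq (x, y) | x <- s, y <- t].
Proof. by move=> s_uniq t_uniq; apply: allpairs_uniq => // -[? ?] [? ?] _ _ /= [-> ->]. Qed.

Lemma finite_recursive_trees n : exists s : seq ltree,
  [/\ uniq s, forall t, t \in s -> size t = n &
      forall t, recursive_tree t -> size t = n -> t \in s].
Proof.
elim: n => [|n [s [_ s_size s_all]]].
  exists [:: [::]]; split => // [t|[|//] _ _]; last by rewrite inE.
  by rewrite inE => /eqP ->.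
exists (undup [seq attach t v | t <- s, v <- iota 1 n.+1]); split.
- exact: undup_uniq.
- by move=> t; rewrite mem_undup => /allpairsP[[u v] /= [/s_size u_n _ ->]] /=; rewrite u_n.
move=> [//|[x y] t] /and3P[x_t /eqP y_t tree_t] [t_n]; rewrite mem_undup.
rewrite /= in x_t y_t; rewrite {}y_t.
apply/allpairsP; exists (t, x); split => //; first exact: s_all.
by rewrite mem_iota /=; lia.
Qed.

(** The law of the n-th tree is carried by finitely many trees. *)
Lemma mean_support (R : realType) n (s : seq ltree) (f : ltree -> R) :
  (0 < n)%N -> uniq s ->
  (forall t, recursive_tree t -> size t = n -> t \in s) ->
  mean n f = \sum_(t <- s) prob R n (pred1 t) * f t.
Proof.
move=> n_gt0 s_uniq s_all.
transitivity (mean n (fun t => \sum_(u <- s) f u * (t == u)%:R)).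
  apply: eq_mean => // t tree_t st.
  rewrite (bigD1_seq t) ?s_all //= eqxx mulr1 big1 ?addr0 // => u /negPf u_t.
  by rewrite eq_sym u_t mulr0.
elim: s {s_uniq s_all} => [|u s IHs].
  rewrite big_nil -[RHS](@mean_cst R n) //; apply: eq_mean => // t _ _.
  by rewrite big_nil.
rewrite big_cons -IHs mulrC -meanZ -meanD; apply: eq_mean => // t _ _.
by rewrite big_cons.
Qed.

(** Fibres of a single map are disjoint. *)
Lemma sum_fiber_le d (T : measurableType d) (R : realType)
    (mu : probability T R) (I : eqType) (g : T -> I) (s : seq I) (E : set T) :
  measurable E -> (forall i, measurable [set w | g w = i]) -> uniq s ->
  (forall i, i \in s -> [set w | g w = i] `<=` E) ->
  (\sum_(i <- s) mu [set w | g w = i] <= mu E)%E.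
Proof.
move=> + mg; elim: s E => [|i s IHs] E mE; first by rewrite big_nil.
move=> /andP[i_s s_uniq] sub; rewrite big_cons.
rewrite (measureDI mu mE (mg i)) addeC.
have -> : E `&` [set w | g w = i] = [set w | g w = i].
  by apply/setIidPr; apply: sub; rewrite mem_head.
apply: leeD => //; apply: IHs => //; first exact: measurableD.
move=> j j_s w gw; split; first by apply: (sub j) => //; rewrite inE j_s orbT.
by move=> /= gw'; move: i_s; rewrite -gw' gw j_s.
Qed.

Section Bridge.
Variables (R : realType) (d : measure_display) (Omega : measurableType d).
Variables (Pr : probability Omega R) (P : nat -> Omega -> ltree).
Variables (X1 X2 : nat -> {RV Pr >-> nat}) (coin : nat -> {RV Pr >-> bool}).
Hypothesis hP : min_choice_pa_tree P X1 X2 coin.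

Lemma pa_attach m w : (0 < m)%N ->
  P m.+1 w = (min_choice (P m w) (X1 m.+1 w) (X2 m.+1 w) (coin m.+1 w), m.+2)
    :: P m w.
Proof. by move=> m_gt0; rewrite (pa_step hP). Qed.

Lemma size_pa m w : (0 < m)%N -> size (P m w) = m.
Proof.
elim: m => // -[_ _|m IHm _]; first by rewrite (pa_init hP).
by rewrite pa_attach //= IHm.
Qed.

Lemma measurable_choices m (A : set (nat * (nat * bool))) :
  measurable [set w | A (X1 m w, (X2 m w, coin m w))].
Proof.
rewrite (_ : [set w | _] = \bigcup_(i in A)
   ((X1 m @^-1` [set i.1]) `&` ((X2 m @^-1` [set i.2.1]) `&`
    (coin m @^-1` [set i.2.2])))); last first.
  apply/seteqP; split => w /=; first by exists (X1 m w, (X2 m w, coin m w)).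
  by move=> [[x [y b]] /= Ai [-> [-> ->]]].
rewrite bigcup_mkcond; apply: countable_bigcupT_measurable; first exact: countableP.
move=> i; case: ifP => // _; do 2?apply: measurableI; exact: measurable_funPTI.
Qed.

Lemma measurable_pa_eq m t : (0 < m)%N -> measurable [set w | P m w = t].
Proof.
elim: m t => // -[_ t _|m IHm t _].
  have [->|t_neq] := eqVneq t [:: (1%N, 2%N)].
    by rewrite (_ : [set w | _] = setT) //; apply/seteqP; split => // w _; rewrite /= (pa_init hP).
  rewrite (_ : [set w | _] = set0) //; apply/seteqP; split => // w /=.
  by rewrite (pa_init hP) => t_eq; rewrite t_eq eqxx in t_neq.
case: t => [|e t].
  rewrite (_ : [set w | _] = set0) //; apply/seteqP; split => // w /= /(congr1 size).
  by rewrite size_pa.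
rewrite (_ : [set w | _] = [set w | P m.+1 w = t] `&`
   [set w | (fun i : nat * (nat * bool) =>
      (min_choice t i.1 i.2.1 i.2.2, m.+3) = e)
      (X1 m.+2 w, (X2 m.+2 w, coin m.+2 w))]).
  by apply: measurableI; [exact: IHm | exact: (@measurable_choices m.+2 (fun i => (min_choice t i.1 i.2.1 i.2.2, m.+3) = e))].
apply/seteqP; split => w /=; rewrite (pa_attach w (ltn0Sn m)).
  by case=> <- <-.
by case=> -> ->.
Qed.

Lemma measurable_pa m (A : pred ltree) : (0 < m)%N ->
  measurable [set w | A (P m w)].
Proof.
move=> m_gt0; rewrite (_ : [set w | _] = \bigcup_(t in [set t | A t])
    [set w | P m w = t]); last first.
  by apply/seteqP; split => w /=; [exists (P m w) | case=> t At ->].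
rewrite bigcup_mkcond; apply: countable_bigcupT_measurable; first exact: countableP.
by move=> t; case: ifP => // _; exact: measurable_pa_eq.
Qed.

(** Lower bounds on the probabilities of an event and of its complement that sum
    to 1 are equalities. *)
Lemma Pr_pa_lower m : (0 < m)%N ->
  (forall A : pred ltree, (prob R m A)%:E <= Pr [set w | A (P m w)])%E ->
  forall A : pred ltree, Pr [set w | A (P m w)] = (prob R m A)%:E.
Proof.
move=> m_gt0 lower A; apply/eqP; rewrite eq_le lower andbT.
have mA := measurable_pa A m_gt0; have := lower (predC A).
rewrite (_ : [set w | predC A (P m w)] = ~` [set w | A (P m w)]); last first.
  by apply/seteqP; split => w /= /negP.
rewrite probability_setC // (_ : prob R m (predC A) = 1 - prob R m A); last first.
  by rewrite -(@probC R m A) // addrAC subrr add0r.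
have : Pr [set w | A (P m w)] \is a fin_num by exact: fin_num_measure.
by case: (Pr _) => // r _; rewrite -EFinB !lee_fin; lra.
Qed.

(** By induction on m: the fibres of the previous tree together with both choices
    and the coin, taken over the finitely many values that the chain allows, are
    disjoint parts of the event.  This gives a lower bound, hence equality. *)
Lemma Pr_pa m (A : pred ltree) : (0 < m)%N ->
  Pr [set w | A (P m w)] = (prob R m A)%:E.
Proof.
move=> m_gt0; elim: m m_gt0 A => // -[_ _|m IHm _]; apply: Pr_pa_lower => // A.
  rewrite /prob /mean /=; case: (boolP (A _)) => A_edge; last exact: measure_ge0.
  rewrite (_ : [set w | _] = setT) ?probability_setT //.
  by apply/seteqP; split => // w _ /=; rewrite (pa_init hP).
pose n := m.+1.
pose g w := (P n w, (X1 n.+1 w, (X2 n.+1 w, coin n.+1 w))).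
pose next (i : ltree * (nat * (nat * bool))) :=
  attach i.1 (min_choice i.1 i.2.1 i.2.2.1 i.2.2.2).
have g_next w : P n.+1 w = next (g w) by rewrite pa_attach // /next /attach size_pa.
have [s [s_uniq s_size s_all]] := finite_recursive_trees n.
pose I := index_iota 0 n.+2.
pose cases := [seq (t, i) | t <- s, i <- [seq (x, j) | x <- I, j <-
   [seq (y, b) | y <- I, b <- index_enum bool]]].
have Pr_case i : Pr [set w | g w = i] =
  (prob R n (pred1 i.1) *
    (deg_prob R i.1 i.2.1 * deg_prob R i.1 i.2.2.1 * 2^-1))%:E.
  case: i => t [x [y b]] /=; rewrite EFinM.
  have -> : (prob R n (pred1 t))%:E = Pr [set w | P n w = t].
    rewrite -IHm //; congr (Pr _); apply/seteqP.
    by split => w /= => [/eqP|->].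
  rewrite -[RHS](pa_choices hP t x y b (isT : (2 <= n.+1)%N)); congr (Pr _); apply/seteqP; rewrite /g.
  by split => w /= => [[-> -> -> ->]|[-> -> -> ->]].
apply: le_trans (@sum_fiber_le _ _ _ Pr _ g [seq i <- cases | A (next i)] _ _ _ _ _).
- rewrite big_filter (eq_bigr _ (fun i _ => Pr_case i)) sumEFin lee_fin.
  rewrite big_mkcond big_allpairs /prob meanS // (mean_support _ _ s_uniq s_all) //.
  rewrite !big_seq; apply: ler_sum => t /s_size t_n.
  rewrite big_allpairs /mean_step t_n mulr_sumr big_mkord; apply: ler_sum => x _.
  rewrite big_allpairs mulr_sumr big_mkord; apply: ler_sum => y _.
  rewrite mulr_sumr; apply: ler_sum => b _; rewrite /next /=.
  by case: (A _); rewrite ?mulr1 ?mulr0.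
- exact: measurable_pa.
- move=> [t i]; rewrite (_ : [set w | _] = [set w | P n w = t] `&`
    [set w | (X1 n.+1 w, (X2 n.+1 w, coin n.+1 w)) = i]).
    apply: measurableI; first exact: measurable_pa_eq.
    exact: (@measurable_choices n.+1 (fun j => j = i)).
  by apply/seteqP; rewrite /g; split => w /= => [[-> ->]|[-> ->]].
- apply: filter_uniq; apply: uniq_pairs => //.
  apply: uniq_pairs; first exact: iota_uniq.
  by apply: uniq_pairs; [exact: iota_uniq | exact: index_enum_uniq].
- by move=> i; rewrite mem_filter => /andP[Ai _] w /= gw; rewrite g_next gw.
Qed.

End Bridge.

Section DoubleLog.
Variable R : realType.

Lemma ln2_bounds : 2^-1 <= (ln 2 : R) <= 1.
Proof.
have quarter : expR (4^-1) <= 21 / 16 :> R.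
  by apply: le_trans (expR_le_quadratic _) _; lra.
have half : expR 2^-1 <= 2 :> R.
  have -> : expR 2^-1 = expR 4^-1 * expR 4^-1 :> R.
    by rewrite -expRD; congr expR; field.
  have := expR_gt0 (4^-1 : R); move: (expR _) quarter => e e_le e_gt0; nra.
have one : 2 <= expR 1 :> R by have := expR_ge1Dx (1 : R); lra.
apply/andP; split; [rewrite -[leLHS]expRK | rewrite -[leRHS]expRK].
  by rewrite ler_ln ?posrE ?expR_gt0.
by rewrite ler_ln ?posrE ?expR_gt0.
Qed.

(** ln 2 lies between 1/2 and 1, so replacing natural logarithms by binary ones
    changes the double logarithm by at most 1. *)
Lemma loglog_bounds m r : (2 ^ 2 ^ r <= m)%N -> (m < 2 ^ 2 ^ r.+1)%N ->
  r%:R - 1 <= (ln (ln m%:R) / ln 2 : R) <= r%:R + 1.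
Proof.
move=> m_ge m_lt; have /andP[ln2_ge ln2_le] := ln2_bounds.
have ln2_gt0 : 0 < ln 2 :> R by lra.
have m_gt0 : (0 : R) < m%:R.
  by rewrite ltr0n; apply: leq_trans m_ge; rewrite expn_gt0.
have ln_ge : 2 ^+ r * ln 2 <= ln m%:R :> R.
  rewrite mulrC -natrX mulr_natr -lnXn // ler_ln ?posrE ?exprn_gt0 //.
  by rewrite -natrX ler_nat.
have ln_le : ln m%:R <= 2 ^+ r.+1 * ln 2 :> R.
  rewrite mulrC -natrX mulr_natr -lnXn // ler_ln ?posrE ?exprn_gt0 //.
  by rewrite -natrX ler_nat ltnW.
have ln_gt0 : 0 < ln m%:R :> R.
  by apply: lt_le_trans ln_ge; rewrite mulr_gt0 ?exprn_gt0.
rewrite ler_pdivlMr // ler_pdivrMr //; apply/andP; split.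
  have -> : (r%:R - 1) * ln 2 = ln (2 ^+ r / 2) :> R.
    by rewrite ln_div ?posrE ?exprn_gt0 // lnXn // -mulr_natr; ring.
  rewrite ler_ln ?posrE ?divr_gt0 ?exprn_gt0 //; apply: le_trans ln_ge.
  by rewrite ler_wpM2l ?exprn_ge0.
have -> : (r%:R + 1) * ln 2 = ln (2 ^+ r.+1) :> R.
  by rewrite lnXn // -[RHS]mulr_natr natr1 mulrC.
rewrite ler_ln ?posrE ?exprn_gt0 //; apply: le_trans ln_le _.
by rewrite ler_piMr ?exprn_ge0.
Qed.

End DoubleLog.

Lemma nat_double_exp_bounds m : (3 < m)%N -> exists2 r,
  (2 ^ 2 ^ r <= m)%N & (m < 2 ^ 2 ^ r.+1)%N.
Proof.
move=> m_gt3; have m_gt0 : (0 < m)%N by lia.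
have /andP[m_ge m_lt] := trunc_log_bounds (isT : 1 < 2)%N m_gt0.
move: (trunc_log 2 m) m_ge m_lt => T m_ge m_lt.
have T_gt0 : (0 < T)%N by case: T m_lt {m_ge} => //; lia.
have /andP[T_ge T_lt] := trunc_log_bounds (isT : 1 < 2)%N T_gt0.
exists (trunc_log 2 T).
  by apply: leq_trans m_ge; rewrite leq_exp2l.
by apply: leq_trans m_lt _; rewrite leq_exp2l.
Qed.

Theorem theorem1p1 (R : realType) (d : measure_display)
    (Omega : measurableType d) (Pr : probability Omega R)
    (P : nat -> Omega -> ltree) (X1 X2 : nat -> {RV Pr >-> nat})
    (coin : nat -> {RV Pr >-> bool})
    (hP : min_choice_pa_tree P X1 X2 coin) :
  exists K : R, 0 < K /\
    with_high_probability Pr (fun m : nat =>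
      [set w | `| (max_degree (P m w))%:R - ln (ln m%:R) / ln 2 | <= K]).
Proof.
(* With r the integer part of log_2 log_2 m, the maximum degree lies between
   r - 4 and r + 10, and the double logarithm between r - 1 and r + 1. *)
exists 12; split => //; rewrite /with_high_probability.
pose A m t : bool := `|(max_degree t)%:R - ln (ln m%:R) / ln 2| <= 12 :> R.
have PrA m : (0 < m)%N -> Pr [set w | A m (P m w)] = (prob R m (A m))%:E.
  exact: (Pr_pa hP).
apply: cvg_EFin.
  by exists 1%N => // m /= m_gt0; rewrite PrA.
apply/cvgrPdist_le => eps eps_gt0.
have eps2_gt0 : 0 < eps / 2 by rewrite divr_gt0.
have [D0 large] := prob_max_degree_large eps2_gt0.
have [N N_gt0 N_ge] := exists_nat_ge (2 / eps).
exists (2 ^ 2 ^ (D0 + N + 4))%N => // m /= m_large.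
have m_gt3 : (3 < m)%N.
  apply: leq_trans m_large; rewrite -[4%N]/(2 ^ 2)%N leq_exp2l //.
  by rewrite -[leqLHS]/(2 ^ 1)%N leq_exp2l //; lia.
have m_gt0 : (0 < m)%N by lia.
have [r m_ge m_lt] := nat_double_exp_bounds m_gt3.
have r_ge : (D0 + N + 4 <= r)%N.
  by have := leq_ltn_trans m_large m_lt; rewrite !ltn_exp2l.
have -> /= : Pr [set w | A m (P m w)] = (prob R m (A m))%:E by exact: PrA.
have := probC R (A m) m_gt0; have := prob_ge0 R (fun t => ~~ A m t) m_gt0.
suff : prob R m (fun t => ~~ A m t) <= eps.
  by move=> le_eps ge0 sum1; rewrite ger0_norm; lra.
rewrite [leRHS]splitr.
apply: (@le_trans _ _ (prob R m (fun t => (max_degree t < r - 4)%N) +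
    prob R m (fun t => (r + 10 < max_degree t)%N))).
  apply: prob_leU => // t _ _; apply: contraR.
  rewrite negb_or -!leqNgt => /andP[deg_ge deg_le].
  have /andP[log_ge log_le] := loglog_bounds R m_ge m_lt.
  have : (max_degree t)%:R <= r%:R + 10 :> R by rewrite -natrD ler_nat.
  have : r%:R <= (max_degree t)%:R + 4 :> R by rewrite -natrD ler_nat; lia.
  by rewrite /A ler_norml; lra.
apply: lerD.
  apply: le_trans (prob_max_degree_small R _ _) _.
  - by lia.
  - apply: leq_trans m_ge; rewrite leq_exp2l // -{2}(subnK (_ : 4 <= r)%N); last lia.
    by rewrite expnD mulnC leq_mul2l; apply/orP; right.
  rewrite -[leRHS]invrK lef_pV2 ?posrE ?invr_gt0 //; last first.
    by rewrite ltr0n; lia.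
  by rewrite invf_div; apply: le_trans N_ge _; rewrite ler_nat; lia.
apply: large; first lia.
rewrite m_gt0 /tower (_ : r + 10 - 9 = r.+1)%N; last lia.
exact: ltnW.
Qed.
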